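(* Let $L=L_1\cup L_2\cup\cdots\cup L_n$ be any $n$-component link in $\mathbb{R}^3$ and let $I\subset\{1,2,\ldots,n\}$ be any subset (possibly empty or all of $\{1,\dots,n\}$). Then there is a time-dependent electromagnetic field $\mathbf{F}=\mathbf{E}+\mathrm{i}\mathbf{B}$ on $\mathbb{R}\times\mathbb{R}^3$ satisfying Maxwell's equations in free space such that for every time $t\in\mathbb{R}$: the field $\mathbf{E}(t,\cdot)$ has a set of closed field lines whose union is ambient isotopic to $\bigcup_{i\in I}L_i$, the field $\mathbf{B}(t,\cdot)$ has a set of closed field lines whose union is ambient isotopic to $\bigcup_{i\notin I}L_i$, and the union of these closed electric and magnetic field lines is a link ambient isotopic to $L$ (with the electric lines corresponding to the components $L_i$, $i\in I$, and the magnetic lines to the components $L_i$, $i\notin I$).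
   Context: An electromagnetic field is represented by its Riemann–Silberstein vector $\mathbf{F}=\mathbf{E}+\mathrm{i}\mathbf{B}$, where $\mathbf{E},\mathbf{B}:\mathbb{R}\times\mathbb{R}^3\to\mathbb{R}^3$ (time $t$, space $(x,y,z)$) are the electric and magnetic fields. Maxwell's equations in free space (units with speed of light $1$) read $\nabla\cdot\mathbf{F}=0$ and $\mathrm{i}\,\partial_t\mathbf{F}=\nabla\times\mathbf{F}$, where $\nabla$ acts on the spatial variables. A closed field line of a vector field $\mathbf{V}$ on $\mathbb{R}^3$ is a closed embedded curve along which $\mathbf{V}$ is nonvanishing and tangent. A link is a smooth embedding of finitely many disjoint circles; links are considered up to ambient isotopy. *)

(* Defs.v *)
From HB Require Import structures.
From mathcomp Require Import all_boot all_order all_algebra.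
From mathcomp Require Import all_classical all_reals all_analysis.
Set Implicit Arguments. Unset Strict Implicit. Unset Printing Implicit Defensive.
Import Order.TTheory GRing.Theory Num.Theory.
Import numFieldNormedType.Exports.
Local Open Scope classical_set_scope.
Local Open Scope ring_scope.

(* C^k regularity via directional derivatives (equivalent, in finite
   dimension, to classical C^k); smooth = C^k for every k. *)
Fixpoint Ck {R : realType} {V W : normedModType R} (k : nat) (f : V -> W) : Prop :=
  match k with
  | 0 => continuous f
  | k.+1 => continuous f /\
      forall v : V, (forall x, derivable f x v) /\ Ck k (fun x => derive f x v)
  end.

Definition smooth {R : realType} {V W : normedModType R} (f : V -> W) : Prop :=
  forall k, Ck k f.

Notation vec3 R := ('rV[R]_3).

Definition ax0 : 'I_3 := @Ordinal 3 0 isT.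
Definition ax1 : 'I_3 := @Ordinal 3 1 isT.
Definition ax2 : 'I_3 := @Ordinal 3 2 isT.

Definition evec {R : realType} (i : 'I_3) : vec3 R := delta_mx 0 i.

Definition pd {R : realType} (V : vec3 R -> vec3 R) (i j : 'I_3) (x : vec3 R) : R :=
  (derive V x (evec i)) 0 j.

Definition divergence {R : realType} (V : vec3 R -> vec3 R) (x : vec3 R) : R :=
  \sum_(i < 3) pd V i i x.

Definition curl {R : realType} (V : vec3 R -> vec3 R) (x : vec3 R) : vec3 R :=
  \row_(k < 3)
    (if k == ax0 then pd V ax1 ax2 x - pd V ax2 ax1 x
     else if k == ax1 then pd V ax2 ax0 x - pd V ax0 ax2 x
     else pd V ax0 ax1 x - pd V ax1 ax0 x).

Definition dt {R : realType} (V : R -> vec3 R -> vec3 R) (t : R) (x : vec3 R) : vec3 R :=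
  derive (fun s : R => V s x) t 1.

(* Maxwell's equations in free space for F = E + iB (c = 1):
   div F = 0 and i d_t F = curl F, i.e. (real and imaginary parts)
   div E = 0, div B = 0, d_t E = curl B, d_t B = - curl E.
   Fields are required to be smooth on spacetime R x R^3. *)
Definition maxwell {R : realType} (E B : R -> vec3 R -> vec3 R) : Prop :=
  smooth (fun p : R * vec3 R => E p.1 p.2) /\
  smooth (fun p : R * vec3 R => B p.1 p.2) /\
  forall t x,
    divergence (E t) x = 0 /\ divergence (B t) x = 0 /\
    dt E t x = curl (B t) x /\ dt B t x = - curl (E t) x.

(* A smooth embedding of a circle R/Z -> R^3, given as a 1-periodic smooth
   map that is injective on [0,1) and has nowhere-vanishing velocity. *)
Definition closed_curve {R : realType} (g : R -> vec3 R) : Prop :=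
  smooth g /\
  (forall s, g (s + 1) = g s) /\
  (forall s u, 0 <= s < 1 -> 0 <= u < 1 -> g s = g u -> s = u) /\
  (forall s, derive g s 1 != 0).

Definition closed_field_line {R : realType} (V : vec3 R -> vec3 R) (g : R -> vec3 R) : Prop :=
  closed_curve g /\
  forall s, V (g s) != 0 /\ exists c : R, derive g s 1 = c *: V (g s).

Definition link {R : realType} (n : nat) (L : 'I_n -> R -> vec3 R) : Prop :=
  (forall i, closed_curve (L i)) /\
  (forall i j, i != j -> range (L i) `&` range (L j) = set0).

Definition ambient_isotopy {R : realType} (H : R -> vec3 R -> vec3 R) : Prop :=
  smooth (fun p : R * vec3 R => H p.1 p.2) /\
  (forall x, H 0 x = x) /\
  (forall t, 0 <= t <= 1 -> exists G : vec3 R -> vec3 R,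
       smooth G /\ cancel (H t) G /\ cancel G (H t)).

(* Main.v *)
(* Take F travelling along z, F(t, x, y, z) = F(x, y, z - t): its field lines are just
   translated, so it suffices to control time 0. With w = x + i y, such an F solves
   Maxwell's equations as soon as F3 = f, F1 + i F2 = g and F1 - i F2 = h + conj q, where
   f, g, h, q are polynomials in conj w with coefficients smooth in z, f and q are
   arbitrary, and g, h come from f by integrating and differentiating the coefficients.
   After a C^1-small ambient isotopy every component of the link is smooth and folds
   quadratically at each zero of z'. Interpolating along the link, one picks f with value
   (1 + i) z', and then q so that the horizontal part of E (resp. B) equals w' on the
   electric (resp. magnetic) components. Interpolation is local in z; over one height it
   is the Chinese remainder theorem, where near a fold the functions on the curve are
   a(z) + b(z) s with s^2 a multiple of z - z0, and s itself is affine in conj w. *)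
Require Import Defs.
From mathcomp Require Import finmap ring lra.
From HB Require Import structures.
From mathcomp Require Import all_boot all_order all_algebra.
From mathcomp Require Import all_classical all_reals all_analysis.
Import Order.TTheory GRing.Theory Num.Theory.
Import numFieldNormedType.Exports.
Local Open Scope classical_set_scope.
Local Open Scope ring_scope.
Set Implicit Arguments. Unset Strict Implicit. Unset Printing Implicit Defensive.

(* C^k by means of iterated tangent maps: this makes the chain rule immediate. *)
Fixpoint Sm {R : realType} (k : nat) :
    forall V W : normedModType R, (V -> W) -> Prop :=
  match k with
  | 0 => fun V W f => continuous f
  | k.+1 => fun V W f => (forall x, differentiable f x) /\
      @Sm R k (V * V)%type W (fun p => 'd f (p.1) p.2)
  end.

Definition sm {R : realType} (V W : normedModType R) (f : V -> W) :=
  forall k, Sm k f.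

Section TangentCalculus.
Context {R : realType}.
Implicit Types U V W : normedModType R.

Lemma Sm_continuous k V W (f : V -> W) : Sm k f -> continuous f.
Proof.
by case: k => [//|k] [df _] x; apply: differentiable_continuous.
Qed.

Lemma sm_continuous V W (f : V -> W) : sm f -> continuous f.
Proof. by move=> /(_ 0%N). Qed.

Lemma sm_differentiable V W (f : V -> W) x : sm f -> differentiable f x.
Proof. by move=> /(_ 1%N) [/(_ x)]. Qed.

Lemma sm_tangent V W (f : V -> W) :
  sm f -> @sm R (V * V)%type W (fun p => 'd f (p.1) p.2).
Proof. by move=> sf k; have [_] := sf k.+1. Qed.

Lemma Sm_cst k V W (c : W) : Sm k (fun _ : V => c).
Proof.
elim: k V c => [|k IH] V c /=; first exact: cst_continuous.
split=> [x|]; first exact: differentiable_cst.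
rewrite [X in Sm k X](_ : _ = fun=> 0); first exact: IH.
by apply/funext => p; rewrite (@diff_cst _ V W c).
Qed.

Lemma Sm_linear k V W (f : {linear V -> W}) : continuous f -> Sm k f.
Proof.
elim: k V f => [//|k IH] V f fc /=; split=> [x|].
  exact: linear_differentiable.
have -> : (fun p : V * V => 'd f (p.1) p.2) = f \o snd.
  by apply/funext => p /=; rewrite diff_lin.
apply: (IH (V * V)%type (f \o snd : {linear _ -> _})) => x.
by apply: continuous_comp; [exact: cvg_snd|exact: fc].
Qed.

Lemma Sm_pair k U V W (f : U -> V) (g : U -> W) :
  Sm k f -> Sm k g -> Sm k (fun x => (f x, g x)).
Proof.
elim: k U f g => [|k IH] U f g /=; first by move=> fc gc x; apply: cvg_pair; [exact: fc|exact: gc].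
move=> [df sf] [dg sg]; split=> [x|]; first exact: differentiable_pair.
rewrite [X in Sm k X](_ : _ = fun p => ('d f (p.1) p.2, 'd g (p.1) p.2)); first exact: IH.
by apply/funext => p; rewrite diff_pair.
Qed.

Lemma Sm_le k V W (f : V -> W) : Sm k.+1 f -> Sm k f.
Proof.
elim: k V f => [|k IH] V f; first exact: (@Sm_continuous 1).
by move=> [df sf]; split=> //; apply: IH.
Qed.

Lemma Sm_fst k U V : Sm k (@fst U V).
Proof. by apply: (Sm_linear k (f := fst : {linear _ -> _})) => x; exact: cvg_fst. Qed.

Lemma Sm_snd k U V : Sm k (@snd U V).
Proof. by apply: (Sm_linear k (f := snd : {linear _ -> _})) => x; exact: cvg_snd. Qed.

Lemma Sm_id k V : Sm k (@id V).
Proof. by apply: (Sm_linear k (f := idfun : {linear V -> V})) => x; exact: cvg_id. Qed.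

Lemma Sm_comp k U V W (g : V -> W) (f : U -> V) :
  Sm k g -> Sm k f -> Sm k (g \o f).
Proof.
elim: k U V W g f => [|k IH] U V W g f.
  by move=> gc fc x; apply: continuous_comp; [exact: fc|exact: gc].
move=> [dg sg] sf; have [df sf'] := sf; split=> [x|]; first exact: differentiable_comp.
have -> : (fun p : U * U => 'd (g \o f) (p.1) p.2) =
   (fun p : V * V => 'd g (p.1) p.2) \o (fun p => (f p.1, 'd f (p.1) p.2)).
  by apply/funext => p /=; rewrite diff_comp.
apply: (IH) => //; apply: Sm_pair => //.
exact: (IH _ _ _ f fst (Sm_le sf) (@Sm_fst k U U)).
Qed.

Lemma sm_cst V W (c : W) : sm (fun _ : V => c).
Proof. by move=> k; apply: Sm_cst. Qed.
Lemma sm_id V : sm (@id V). Proof. by move=> k; apply: Sm_id. Qed.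
Lemma sm_fst U V : sm (@fst U V). Proof. by move=> k; apply: Sm_fst. Qed.
Lemma sm_snd U V : sm (@snd U V). Proof. by move=> k; apply: Sm_snd. Qed.
Lemma sm_pair U V W (f : U -> V) (g : U -> W) :
  sm f -> sm g -> sm (fun x => (f x, g x)).
Proof. by move=> sf sg k; apply: Sm_pair. Qed.
Lemma sm_comp U V W (g : V -> W) (f : U -> V) : sm g -> sm f -> sm (g \o f).
Proof. by move=> sf sg k; apply: Sm_comp. Qed.

Lemma Sm_add k V : Sm k (fun p : V * V => p.1 + p.2).
Proof.
apply: (Sm_linear k (f := (fst \+ snd) : {linear _ -> _})) => x.
by apply: cvgD; [exact: cvg_fst|exact: cvg_snd].
Qed.

Lemma SmD k V W (f g : V -> W) : Sm k f -> Sm k g -> Sm k (fun x => f x + g x).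
Proof. by move=> sf sg; exact: (Sm_comp (Sm_add k W) (Sm_pair sf sg)). Qed.

Lemma smD V W (f g : V -> W) : sm f -> sm g -> sm (fun x => f x + g x).
Proof. by move=> sf sg k; exact: SmD. Qed.

Lemma smN V W (f : V -> W) : sm f -> sm (fun x => - f x).
Proof.
move=> sf; apply: (@sm_comp _ _ _ (fun x : W => - x) f) => // k.
apply: (Sm_linear k (f := (-%R) : {linear W -> W})) => x.
exact: opp_continuous.
Qed.

Lemma smB V W (f g : V -> W) : sm f -> sm g -> sm (fun x => f x - g x).
Proof. by move=> sf sg; apply: smD => //; apply: smN. Qed.

Lemma sm_scale V : sm (fun p : R * V => p.1 *: p.2).
Proof.
move=> k.
suff H (U : normedModType R) (f : U -> R) (g : U -> V) :
    Sm k f -> Sm k g -> Sm k (fun x => f x *: g x).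
  by apply: H; [exact: Sm_fst|exact: Sm_snd].
elim: k U f g => [|k IH] U f g.
  by move=> sf sg x; apply: cvgZ; [exact: sf|exact: sg].
have dsc (p : R * V) : is_diff p (fun q : R * V => q.1 *: q.2) (fun q => p.1 *: q.2 + q.1 *: p.2).
  have sc : continuous (fun q : R * V => q.1 *: q.2) by exact: scale_continuous.
  have bl : bilinear_for (GRing.Scale.Law.clone _ _ *:%R _) (GRing.Scale.Law.clone _ _ *:%R _)
     (fun (a : R) (v : V) => a *: v).
    split=> [u'|u] a x y /=.
    - by rewrite scalerDl scalerA.
    - by rewrite scalerDr !scalerA mulrC.
  pose bM := bilinear_isBilinear.Build R R V V _ _ _ bl.
  pose B : {bilinear R -> V -> V} := HB.pack (fun (a : R) (v : V) => a *: v) bM.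
  by apply: DiffDef; [exact: (@differentiable_bilin _ _ _ _ B)|exact: (@diff_bilin _ _ _ _ B)].
move=> [df sf] [dg sg]; split=> [x|].
  apply: (@differentiable_comp _ U _ V (fun x => (f x, g x)) (fun q => q.1 *: q.2)).
    exact: differentiable_pair.
  by case: (dsc (f x, g x)).
rewrite [X in Sm k X](_ : _ = fun p => f p.1 *: 'd g (p.1) p.2 + 'd f (p.1) p.2 *: g p.1).
  have sf1 := Sm_comp (@Sm_le k U R f (conj df sf)) (@Sm_fst k U U).
  have sg1 := Sm_comp (@Sm_le k U V g (conj dg sg)) (@Sm_fst k U U).
  exact: (SmD (IH _ _ _ sf1 sg) (IH _ _ _ sf sg1)).
apply/funext => p.
have dp := differentiable_pair (df p.1) (dg p.1).
rewrite (_ : (fun x => f x *: g x) = (fun q => q.1 *: q.2) \o (fun x => (f x, g x))) //.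
have [ds Es] := dsc (f p.1, g p.1).
apply: etrans (congr1 (fun F : U -> V => F p.2) (diff_comp dp ds)) _.
apply: etrans (congr1 (fun F : (R * V)%type -> V => F ('d (fun x => (f x, g x)) (p.1) p.2)) Es) _.
have Ep := congr1 (fun F : U -> (R * V)%type => F p.2) (diff_pair (df p.1) (dg p.1)).
exact: (congr1 (fun q : (R * V)%type => f p.1 *: q.2 + q.1 *: g p.1) Ep).
Qed.

Lemma smZ V W (f : V -> R) (g : V -> W) : sm f -> sm g -> sm (fun x => f x *: g x).
Proof. by move=> sf sg; exact: (sm_comp (sm_scale W) (sm_pair sf sg)). Qed.

Lemma smM V (f g : V -> R) : sm f -> sm g -> sm (fun x => f x * g x).
Proof. exact: (@smZ V R). Qed.

Lemma smX V (f : V -> R) n : sm f -> sm (fun x => f x ^+ n).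
Proof.
move=> sf; elim: n => [|n IH]; first exact: sm_cst.
by rewrite (_ : (fun x => _) = fun x => f x * f x ^+ n);
  [exact: smM|apply/funext => x; rewrite exprS].
Qed.

Lemma sm_sum V W (I : Type) (r : seq I) (P : pred I) (f : I -> V -> W) :
  (forall i, P i -> sm (f i)) -> sm (fun x => \sum_(i <- r | P i) f i x).
Proof.
move=> sf; elim: r => [|i r IH].
  by rewrite (_ : (fun x => _) = fun=> 0); [exact: sm_cst|apply/funext => x; rewrite big_nil].
rewrite (_ : (fun x => _) = if P i then fun x => f i x + \sum_(i <- r | P i) f i x else fun x => \sum_(i <- r | P i) f i x).
  by case: ifP => // Pi; apply: smD => //; apply: sf.
by apply/funext => x; rewrite big_cons; case: ifP.
Qed.

Lemma SmZ k V W (f : V -> R) (g : V -> W) :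
  Sm k f -> Sm k g -> Sm k (fun x => f x *: g x).
Proof. by move=> sf sg; exact: (Sm_comp (@sm_scale W k) (Sm_pair sf sg)). Qed.

Lemma SmM k V (f g : V -> R) : Sm k f -> Sm k g -> Sm k (fun x => f x * g x).
Proof. exact: (@SmZ k V R). Qed.

Lemma SmV k V (f : V -> R) : (forall x, f x != 0) -> Sm k f -> Sm k (fun x => (f x)^-1).
Proof.
elim: k V f => [|k IH] V f f0 sf.
  by move=> x; apply: cvgV => //; exact: sf.
have [df sdf] := sf.
split=> [x|]; first exact: differentiableV.
rewrite [X in Sm k X](_ : _ = fun p => (- 1) * 'd f (p.1) p.2 * ((f p.1 * f p.1))^-1); last first.
  apply/funext => p.
  apply: etrans (congr1 (fun F : V -> R => F p.2) (diffV (df p.1) (f0 p.1))) _.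
  rewrite -[LHS]/(- f p.1 ^- 2 * 'd f (p.1) p.2).
  rewrite mulN1r !mulNr; congr (- _).
  by rewrite -expr2 mulrC.
have sf1 := Sm_comp (Sm_le sf) (@Sm_fst k V V).
apply: SmM; first by apply: SmM => //; exact: Sm_cst.
by apply: (IH _ (fun p : V * V => f p.1 * f p.1)) => [p|]; [rewrite mulf_neq0|exact: SmM].
Qed.

Lemma smV V (f : V -> R) : (forall x, f x != 0) -> sm f -> sm (fun x => (f x)^-1).
Proof. by move=> f0 sf k; exact: SmV. Qed.

Lemma diff_near V W (f g : V -> W) (x : V) : {near x, f =1 g} ->
  differentiable f x -> differentiable g x /\ 'd g x = 'd f x :> (V -> W).
Proof.
move=> fg df.
have fgx : f x = g x by exact: (nbhs_singleton fg).
have E : g \o shift x = cst (g x) + 'd f x +o_ 0 id.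
  have := diff_locally df => /eqaddoP H.
  apply/eqaddoP => e e0; have {H} := H e e0.
  have : \forall y \near 0, f (y + x) = g (y + x).
    by move: fg; rewrite (near_shift 0 x) /=; apply: filterS => y; rewrite /= subr0.
  by apply: filterS2 => y /=; rewrite !fctE /= => -> ; rewrite fgx.
have E2 : 'd g x = 'd f x :> (V -> W).
  by apply: diff_unique => //; exact: diff_continuous.
split=> //; apply/diff_locallyP; rewrite E2; split=> //.
exact: diff_continuous.
Qed.

Lemma Sm_local k V W (f : V -> W) :
  (forall x : V, exists2 g : V -> W, Sm k g & {near x, f =1 g}) -> Sm k f.
Proof.
elim: k V f => [|k IH] V f H.
  move=> x; have [g gc fg] := H x.
  have fgx := nbhs_singleton fg; rewrite /continuous_at fgx.
  apply: cvg_trans (gc x).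
  by apply: near_eq_cvg; move: fg; apply: filterS => y ->.
have D x g : Sm k.+1 g -> {near x, f =1 g} ->
    differentiable f x /\ 'd f x = 'd g x :> (V -> W).
  move=> [dg _] fg; apply: diff_near; last exact: dg.
  by move: fg; apply: filterS => y ->.
split=> [x|]; first by have [g sg /(D _ _ sg) []] := H x.
apply: IH => -[x v]; have [g sg fg] := H x.
exists (fun p => 'd g (p.1) p.2); first by case: sg.
have : \forall y \near x, {near y, f =1 g} by apply: near_join.
move=> h; exists ([set y | {near y, f =1 g}], setT) => /=.
  by split=> //; exact: filterT.
move=> [y w] [fgy _]; have [_ E] := D y g sg fgy.
exact: (congr1 (fun F : V -> W => F w) E).
Qed.

Lemma sm_local V W (f : V -> W) :
  (forall x : V, exists2 g : V -> W, sm g & {near x, f =1 g}) -> sm f.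
Proof.
by move=> H k; apply: Sm_local => x; have [g sg fg] := H x; exists g.
Qed.

Lemma sm_smooth V W (f : V -> W) : sm f -> smooth f.
Proof.
move=> sf k; elim: k f sf => [|k IH] f sf; first exact: (sm_continuous sf).
split=> [|v]; first exact: (sm_continuous sf).
split=> [x|]; first by apply/diff_derivable/sm_differentiable.
apply: IH; rewrite (_ : (fun x => _) = (fun p => 'd f (p.1) p.2) \o (fun x => (x, v))).
  apply: (@sm_comp V (V * V)%type W); first exact: sm_tangent.
  by apply: sm_pair; [exact: sm_id|exact: sm_cst].
by apply/funext => x /=; rewrite deriveE //; exact: sm_differentiable.
Qed.

Lemma Sm_derive1 k W (f f' : R -> W) :
  (forall x : R, is_derive x (1 : R) f (f' x)) -> Sm k f' -> Sm k.+1 f.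
Proof.
move=> df sf'.
have dff x : differentiable f x by apply/derivable1_diffP; case: (df x).
split=> //.
rewrite [X in Sm k X](_ : _ = fun p => p.2 *: f' p.1).
  exact: (Sm_comp (@sm_scale W k) (Sm_pair (@Sm_snd k R R) (Sm_comp sf' (@Sm_fst k R R)))).
apply/funext => p; rewrite diff1E // derive1E; congr (_ *: _).
by case: (df p.1).
Qed.

Lemma sm_derive1 W (f f' : R -> W) :
  (forall x : R, is_derive x (1 : R) f (f' x)) -> sm f' -> sm f.
Proof. by move=> df sf k; exact: (Sm_le (Sm_derive1 df (sf k))). Qed.

Lemma smooth_sm W (f : R -> W) : smooth f -> sm f.
Proof.
move=> sf k.
have : Ck k f by exact: sf.
elim: k f {sf} => [//|k IH] f [fc /(_ 1) [df cf]].
apply: (@Sm_derive1 k W f (fun x => 'D_1 f x)); last exact: IH.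
by move=> x; apply: DeriveDef.
Qed.

Lemma sm_derive W V (f : V -> W) v : sm f -> sm (fun x => 'D_v f x).
Proof.
move=> sf; rewrite (_ : (fun x => _) = (fun p => 'd f (p.1) p.2) \o (fun x => (x, v))).
  apply: (@sm_comp V (V * V)%type W); first exact: sm_tangent.
  by apply: sm_pair; [exact: sm_id|exact: sm_cst].
by apply/funext => x /=; rewrite deriveE //; exact: sm_differentiable.
Qed.

Lemma sm_is_derive W V (f : V -> W) x v : sm f -> is_derive x v f ('D_v f x).
Proof.
by move=> sf; apply: DeriveDef => //; apply/diff_derivable/sm_differentiable.
Qed.

Lemma sm_coord n j : sm (fun x : 'rV[R]_n.+1 => x 0 j : R).
Proof.
move=> k.
have @f : {linear 'rV[R]_n.+1 -> R}.
  by exists (fun N : 'rV[R]_n.+1 => N 0 j); do 2![eexists]; do ?[constructor];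
     rewrite ?mxE// => ? *; rewrite ?mxE//; move=> ?; rewrite !mxE.
by apply: (@Sm_linear k _ _ f); exact: coord_continuous.
Qed.

Lemma sm_row V n (f : V -> 'rV[R]_n.+1) :
  (forall j, sm (fun x => f x 0 j)) -> sm f.
Proof.
move=> sf; rewrite (_ : f = fun x => \sum_(j < n.+1) f x 0 j *: delta_mx 0 j).
  by apply: sm_sum => j _; apply: smZ => //; exact: sm_cst.
by apply/funext => x; rewrite [LHS]row_sum_delta.
Qed.

End TangentCalculus.

Section RealFunctions.
Context {R : realType}.

Lemma MVT_le (f f' : R -> R) (a b : R) : a <= b ->
  (forall x, a <= x <= b -> is_derive x 1 f (f' x)) ->
  exists2 c, a <= c <= b & f b - f a = f' c * (b - a).
Proof.
move=> ab df.
have h1 x : x \in `]a, b[%R -> is_derive x 1 f (f' x).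
  by rewrite in_itv /= => /andP[? ?]; apply: df; rewrite !ltW.
have h2 : {within `[a, b], continuous f}.
  by apply: derivable_within_continuous => x; rewrite in_itv /= => /df [].
have [c cab E] := MVT_segment ab h1 h2.
by exists c => //; move: cab; rewrite in_itv.
Qed.

Lemma derive_bound (f f' : R -> R) (M : R) (x y : R) :
  (forall x : R, is_derive x 1 f (f' x)) -> (forall x, `|f' x| <= M) ->
  `|f x - f y| <= M * `|x - y|.
Proof.
move=> df bf; wlog yx : x y / y <= x.
  move=> H; case: (leP y x) => [/H//|/ltW/H h].
  by rewrite distrC (distrC x).
have [c _ ->] := MVT_le yx (fun z _ => df z).
by rewrite normrM ler_wpM2r.
Qed.

Lemma eq_is_derive_sub (f g h : R -> R) (a x y : R) : a < x -> a < y ->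
  (forall z, a < z -> is_derive z 1 f (h z)) ->
  (forall z, a < z -> is_derive z 1 g (h z)) ->
  f x - f y = g x - g y.
Proof.
move=> ax ay df dg.
wlog yx : x y ax ay / y <= x.
  move=> H; case: (leP y x) => [/H->//|/ltW/H hh].
  by apply/oppr_inj; rewrite !opprB hh.
have dfg z : y <= z <= x -> is_derive z 1 (f \- g) 0.
  move=> /andP[yz _]; have az := lt_le_trans ay yz.
  by have := is_deriveB (df z az) (dg z az); rewrite subrr.
have [c _] := MVT_le yx dfg.
rewrite mul0r /= => E; lra.
Qed.

Lemma primitive_right (f : R -> R) (a : R) : continuous f ->
  exists F : R -> R, forall x, a < x -> is_derive x 1 F (f x).
Proof.
move=> fc.
exists (fun x => (\int[lebesgue_measure]_(t in [set` Interval (BLeft a) (BRight x)]) (f t))%R).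
move=> x ax.
have xu : x < x + 1 by rewrite ltrDl.
have fi : (lebesgue_measure : {measure set (measurableTypeR R) -> \bar R}).-integrable [set` Interval (BLeft a) (BRight (x + 1))] (EFin \o f).
  apply: continuous_compact_integrable; first exact: segment_compact.
  exact: continuous_subspaceT.
have axb : (a%:E < x%:E)%E by rewrite lte_fin.
have [dF <-] := continuous_FTC1 xu fi axb (fc x).
exact: (DeriveDef dF (esym (derive1E _ _))).
Qed.

Lemma primitive (f : R -> R) : continuous f ->
  exists F : R -> R, forall x : R, is_derive x 1 F (f x).
Proof.
move=> fc; have [F dF] := choice (fun a => primitive_right a fc).
pose G a x := F a x - F a 0.
have Gab a b x : a < 0 -> b < 0 -> a < x -> b < x -> G a x = G b x.
  move=> a0 b0 ax bx.
  have [h1 h2] : Num.max a b < x /\ Num.max a b < 0 by rewrite !gt_max ax bx a0 b0.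
  by apply: (eq_is_derive_sub h1 h2) => z; rewrite gt_max => /andP[? ?]; apply: dF.
exists (fun x => G (- `|x| - 1) x) => x.
have dG : is_derive x 1 (G (- `|x| - 2)) (f x).
  have := @is_deriveB _ _ _ (F (- `|x| - 2)) (cst (F (- `|x| - 2) 0)) x 1 (f x) 0 _ (is_derive_cst _ _ _).
  rewrite subr0; apply; apply: dF; have := ler_norm (- x); rewrite normrN; lra.
apply: near_eq_is_derive dG.
near=> y.
have yx : `|y - x| < 1 by near: y; apply/nbhs_normP; exists 1 => //= y; rewrite distrC.
have h : `|y| < `|x| + 1.
  by rewrite -(subrK x y); apply: (le_lt_trans (ler_normD _ _)); rewrite addrC ltrD2l.
have hy := ler_norm (- y); rewrite normrN in hy.
have y0 := normr_ge0 y; have x0 := normr_ge0 x.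
apply: Gab; lra.
Unshelve. all: by end_near. Qed.

Lemma sm_primitive (f : R -> R) : sm f ->
  exists2 F : R -> R, sm F & forall x : R, is_derive x 1 F (f x).
Proof.
move=> sf; have [F dF] := primitive (sm_continuous sf).
by exists F => //; apply: sm_derive1 dF sf.
Qed.

Lemma compact_bound (f : R -> R) (a b : R) : continuous f ->
  exists2 M, 0 <= M & forall x, a <= x <= b -> `|f x| <= M.
Proof.
move=> fc; have [ab|ab] := leP a b; last first.
  by exists 0 => // x /andP[h1 h2]; have := le_trans h1 h2; rewrite leNgt ab.
have nc : {within `[a, b], continuous (fun x => `|f x|)}.
  apply: continuous_subspaceT => x; apply: continuous_comp; first exact: fc.
  exact: norm_continuous.
have [c cab H] := EVT_max ab nc.
by exists `|f c| => // x xab; apply: H; rewrite in_itv.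
Qed.

End RealFunctions.

Lemma compact_ind {R : realType} (V : normedModType R) (K : set V) (P : set V -> Prop) :
  compact K -> P set0 ->
  (forall A B, B `<=` A -> P A -> P B) ->
  (forall x, K x -> exists2 r : R, 0 < r & forall A, P A -> P (A `|` ball x r)) ->
  P K.
Proof.
move=> cK P0 mono H.
have [r Hr] : exists r : V -> R, forall x, K x -> 0 < r x /\ forall A, P A -> P (A `|` ball x (r x)).
  have /choice[r hr] : forall x, exists r : R, K x -> 0 < r /\ forall A, P A -> P (A `|` ball x r).
    move=> x; have [Kx|nKx] := pselect (K x); last by exists 1.
    by have [r r0 h] := H x Kx; exists r.
  by exists r.
move: cK; rewrite compact_cover => /(_ V K (fun x => ball x (r x))) [].
- by move=> x Kx; apply: ball_open; have [] := Hr x Kx.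
- by move=> x Kx; exists x => //; apply: ballxx; have [] := Hr x Kx.
move=> D DK KD; apply: (mono _ _ KD); rewrite /cover.
have lK : forall x, x \in (enum_fset D : seq V) -> K x by move=> x /DK; rewrite inE.
rewrite (_ : [set` D] = [set` (enum_fset D : seq V)]) //.
elim: (enum_fset D : seq V) lK => [|x l IH] lK.
  by apply: mono P0 => y [].
have [x0 Hx] := Hr x (lK x (mem_head _ _)).
have {}IH := IH (fun y yl => lK y (@mem_behead _ (x :: l) _ yl)).
apply: mono (Hx _ IH) => y [z] /=; rewrite inE => /orP[/eqP->|zl] yz; first by right.
by left; exists z.
Qed.

Section DeriveRules.
Context {R : realType}.
Implicit Types f g : R -> R.

Lemma is_deriveMf f g (x a b : R) : is_derive x 1 f a -> is_derive x 1 g b ->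
  is_derive x 1 (fun y => f y * g y) (a * g x + f x * b).
Proof.
move=> df dg; apply: (is_derive_eq (is_deriveM df dg)).
by rewrite addrC /GRing.scale /= (mulrC a).
Qed.

Lemma is_deriveXf f n (x a : R) : is_derive x 1 f a ->
  is_derive x 1 (fun y => f y ^+ n) (n%:R * f x ^+ n.-1 * a).
Proof.
move=> df; elim: n => [|n IH].
  by rewrite !mul0r; apply: is_derive_cst.
rewrite (_ : (fun y => _) = fun y => f y * f y ^+ n); last first.
  by apply/funext => y; rewrite exprS.
apply: (is_derive_eq (is_deriveMf df IH)).
case: n {IH} => [|n] /=; first by rewrite !expr0; ring.
by rewrite -natr1 exprS; ring.
Qed.

Lemma is_derive_compf f g (x a b : R) : is_derive (g x) 1 f a ->
  is_derive x 1 g b -> is_derive x 1 (fun y => f (g y)) (a * b).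
Proof. exact: is_derive1_comp. Qed.

Lemma is_deriveVf f (x a : R) : f x != 0 -> is_derive x 1 f a ->
  is_derive x 1 (fun y => (f y)^-1) (- a / f x ^+ 2).
Proof.
move=> f0 df; apply: (is_derive_eq (is_deriveV f0 df)).
by rewrite /GRing.scale /= mulNr mulrC mulNr.
Qed.

End DeriveRules.

Section SmoothStep.
Context {R : realType}.

Definition flat (k : nat) (x : R) : R :=
  if 0 < x then x^-1 ^+ k * expR (- x^-1) else 0.

Lemma flatN k x : x <= 0 -> flat k x = 0.
Proof. by rewrite /flat ltNge => ->. Qed.

Lemma flatP k x : 0 < x -> flat k x = x^-1 ^+ k * expR (- x^-1).
Proof. by rewrite /flat => ->. Qed.

Lemma flat_bound k x : `|flat k x| <= k.+1`!%:R * `|x|.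
Proof.
rewrite /flat; case: ltP => x0; last by rewrite normr0 mulr_ge0.
have y0 : 0 < x^-1 by rewrite invr_gt0.
rewrite (gtr0_norm x0) gtr0_norm; last by rewrite mulr_gt0 ?exprn_gt0 ?expR_gt0.
rewrite expRN ler_pdivrMr ?expR_gt0 // -(ler_pM2l y0) -exprS.
have f0 : 0 < (k.+1`!%:R : R) by rewrite ltr0n fact_gt0.
have -> : x^-1 * (k.+1`!%:R * x * expR x^-1) = k.+1`!%:R * expR x^-1.
  by field; rewrite gt_eqF.
rewrite mulrC -ler_pdivrMr //.
apply: le_trans (expR_ge1Dxn k (ltW y0)).
by rewrite lerDr.
Qed.

Lemma flat_derive k (x : R) :
  is_derive x 1 (flat k) (- k%:R * flat k.+1 x + flat k.+2 x).
Proof.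
have [x0|x0|->] := ltgtP x 0.
- rewrite !flatN ?ltW // mulr0 addr0.
  apply: (near_eq_is_derive (f := cst 0)).
  near=> y; rewrite flatN //.
  by near: y; exact: lt_le_nbhsl.
- apply: (near_eq_is_derive (f := fun x : R => x^-1 ^+ k * expR (- x^-1))).
    near=> y; rewrite flatP //.
    by near: y; exact: lt_nbhsr.
  have xn0 : x != 0 by rewrite gt_eqF.
  have d1 := is_deriveVf (f := id) xn0 (is_derive_id x 1).
  have d2 := is_derive_compf (is_derive_expR _) (is_deriveN d1).
  apply: (is_derive_eq (is_deriveMf (is_deriveXf k d1) d2)).
  rewrite !flatP //= !fctE; case: k => [|k] /=.
    by rewrite !expr0; field.
  by rewrite -natr1 !exprS; field.
- rewrite !flatN // mulr0 addr0.
  have cv : (fun h : R => h^-1 *: (flat k (h *: 1 + 0) - flat k 0)) h @[h --> 0^'] --> (0 : R).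
    apply/cvgr0Pnorm_le => e e0; near=> h.
    have h0 : h != 0 by near: h; exact: nbhs_dnbhs_neq.
    rewrite (flatN k (lexx 0)) subr0 addr0 [h *: 1]mulr1.
    have -> : h^-1 *: flat k h = flat k.+1 h.
      rewrite /flat; case: ifP => _; last by rewrite scaler0.
      by rewrite exprS -mulrA.
    apply: le_trans (flat_bound _ _) _.
    have f0 : 0 < (k.+2`!%:R : R) by rewrite ltr0n fact_gt0.
    rewrite mulrC -ler_pdivlMr //.
    near: h; apply: dnbhs0_le; exact: divr_gt0.
  by apply: DeriveDef; [apply/cvg_ex; exists 0|exact: cvg_lim].
Unshelve. all: by end_near. Qed.

Lemma sm_flat k : sm (flat k).
Proof.
move=> m; elim: m k => [|m IH] k.
  move=> x; have [dk _] := flat_derive k x.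
  by apply: differentiable_continuous; apply/derivable1_diffP.
apply: Sm_derive1 (flat_derive k) _.
apply: SmD; last exact: IH.
exact: (Sm_comp (@sm_scale R R m) (Sm_pair (@Sm_cst R m R R (- k%:R)) (IH k.+1))).
Qed.

Definition step (x : R) : R := flat 0 x / (flat 0 x + flat 0 (1 - x)).

Lemma flat_ge0 x : 0 <= flat 0 x.
Proof.
by rewrite /flat; case: ifP => // _; rewrite expr0 mul1r expR_ge0.
Qed.

Lemma flat_gt0 x : 0 < x -> 0 < flat 0 x.
Proof. by move=> x0; rewrite flatP // expr0 mul1r expR_gt0. Qed.

Lemma step_den_gt0 x : 0 < flat 0 x + flat 0 (1 - x).
Proof.
have [x0|x0] := ltP 0 x.
  by apply: ltr_wpDr (flat_gt0 x0); exact: flat_ge0.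
by apply: ltr_wpDl; [exact: flat_ge0|apply: flat_gt0; lra].
Qed.

Lemma sm_step : sm step.
Proof.
apply: smM; first exact: sm_flat.
apply: smV => [x|]; first by rewrite gt_eqF // step_den_gt0.
apply: smD; first exact: sm_flat.
by apply: (sm_comp (sm_flat 0)); apply: smB; [exact: sm_cst|exact: sm_id].
Qed.

Lemma step_le0 x : x <= 0 -> step x = 0.
Proof. by move=> x0; rewrite /step flatN // mul0r. Qed.

Lemma step_ge1 x : 1 <= x -> step x = 1.
Proof.
move=> x1; have := step_den_gt0 x.
rewrite /step (flatN _ (x := 1 - x)) ?addr0; last by lra.
by move=> h; rewrite mulfV // gt_eqF.
Qed.

Lemma step_itv x : 0 <= step x <= 1.
Proof.
rewrite /step divr_ge0 ?flat_ge0 //=; last exact: ltW (step_den_gt0 x).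
by rewrite ler_pdivrMr ?step_den_gt0 // mul1r lerDl flat_ge0.
Qed.

Definition cutoff (x : R) : R := step (2 - x) * step (2 + x).

Lemma sm_cutoff : sm cutoff.
Proof.
apply: smM; apply: (sm_comp sm_step).
  by apply: smB; [exact: sm_cst|exact: sm_id].
by apply: smD; [exact: sm_cst|exact: sm_id].
Qed.

Lemma cutoff1 x : `|x| <= 1 -> cutoff x = 1.
Proof.
by rewrite ler_norml => /andP[h1 h2]; rewrite /cutoff !step_ge1 ?mulr1 //; lra.
Qed.

Lemma cutoff0 x : 2 <= `|x| -> cutoff x = 0.
Proof.
rewrite ler_normr => /orP[h|h]; rewrite /cutoff.
  by rewrite step_le0 ?mul0r //; lra.
by rewrite mulrC step_le0 ?mul0r //; lra.
Qed.

Lemma cutoff_itv x : 0 <= cutoff x <= 1.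
Proof.
have /andP[h1 h2] := step_itv (2 - x); have /andP[h3 h4] := step_itv (2 + x).
by rewrite mulr_ge0 //= mulr_ile1.
Qed.

Lemma cutoff_lipschitz : exists2 K, 0 <= K & forall x y, `|cutoff x - cutoff y| <= K * `|x - y|.
Proof.
have sd := sm_derive (1 : R) sm_cutoff.
have [K K0 HK] := compact_bound (-3) 3 (sm_continuous sd).
exists K => // x y; apply: (derive_bound (f' := fun x => 'D_1 cutoff x)) => [z|z].
  exact: sm_is_derive sm_cutoff.
have [zle|zgt] := leP `|z| 3.
  by apply: HK; rewrite -ler_norml.
suff -> : 'D_1 cutoff z = 0 by rewrite normr0.
rewrite (@near_eq_derive _ _ _ _ (cst 0) z 1); first exact: derive_cst.
near=> y0; rewrite cutoff0 //.
have : `|z - y0| < 1 by near: y0; apply/nbhs_normP; exists 1 => //=; exact: ltr01.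
have := ler_normD (z - y0) y0; rewrite subrK; lra.
Unshelve. all: by end_near. Qed.

End SmoothStep.

Section Shear.
Context {R : realType}.

Definition lip (V : normedModType R) (K : R) (f : V -> R) :=
  forall x y, `|f x - f y| <= K * `|x - y|.

Lemma lip_derive (V : normedModType R) (K : R) (f : V -> R) x v :
  lip K f -> differentiable f x -> `|'d f x v| <= K * `|v|.
Proof.
move=> lf df; rewrite -deriveE //.
have /cvg_ex[l cl] : derivable f x v by exact: diff_derivable.
have -> : 'D_v f x = l by exact: (cvg_lim _ cl).
have cn : (fun h : R => `|h^-1 *: (f (h *: v + x) - f x)|) h @[h --> 0^'] --> `|l|.
  exact: (cvg_norm cl).
have -> : `|l| = lim ((fun h : R => `|h^-1 *: (f (h *: v + x) - f x)|) h @[h --> 0^']).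
  by symmetry; exact: (cvg_lim _ cn).
apply: limr_le; first by apply/cvg_ex; exists `|l|.
near=> h; have h0 : h != 0 by near: h; exact: nbhs_dnbhs_neq.
rewrite normrZ normfV ler_pdivrMl ?normr_gt0 //.
apply: le_trans (lf _ _) _.
by rewrite addrK normrZ mulrCA.
Unshelve. all: by end_near. Qed.

Lemma lip_continuous (V : normedModType R) (K : R) (f : V -> R) :
  0 <= K -> lip K f -> continuous f.
Proof.
move=> K0 lf x; have K1 : 0 < K + 1 by lra.
apply/cvgrPdist_le => e e0; near=> y.
apply: le_trans (lf _ _) _.
have : `|x - y| <= e / (K + 1).
  near: y; apply: cvgr_dist_le; first exact: cvg_id.
  exact: divr_gt0.
rewrite ler_pdivlMr // => h; apply: le_trans h.
by rewrite mulrC ler_wpM2l // lerDl.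
Unshelve. all: by end_near. Qed.

(* The inverse is y - t *: e, where t is the fixed point of t |-> d (y - t *: e). *)
Lemma shear_inverse (V : normedModType R) (K : R) (d : V -> R) (e : V) :
  sm d -> 0 <= K -> lip K d -> K * `|e| <= 2^-1 ->
  exists g : V -> V, [/\ sm g, cancel (fun x => x + d x *: e) g,
    cancel g (fun x => x + d x *: e) & forall x y, `|g x - g y| <= 2 * `|x - y|].
Proof.
move=> sd K0 ld Ke.
have fixp y : exists t, t = d (y - t *: e).
  pose h t := t - d (y - t *: e).
  pose M := 2 * `|d y|.
  have M0 : 0 <= M by rewrite mulr_ge0.
  have hc : continuous h.
    apply: sm_continuous; apply: smB; first exact: sm_id.
    apply: (@sm_comp R R V R d (fun t => y - t *: e)) => //.
    by apply: smB; [exact: sm_cst|apply: smZ; [exact: sm_id|exact: sm_cst]].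
  have hb t : `|d (y - t *: e)| <= `|d y| + 2^-1 * `|t|.
    rewrite -[d (y - _)](subrK (d y)) addrC.
    apply: le_trans (ler_normD _ _) _; rewrite lerD2l.
    apply: le_trans (ld _ _) _; rewrite addrAC subrr sub0r normrN normrZ.
    by rewrite mulrCA mulrC ler_wpM2r.
  have MM : - M <= M by lra.
  have [|t _ ht] := IVT MM (continuous_subspaceT hc) (v := 0); last first.
    by exists t; move: ht; rewrite /h; lra.
  have := hb M; have := hb (- M); rewrite normrN (ger0_norm M0) !ler_norml.
  move=> /andP[a1 a2] /andP[a3 a4].
  rewrite ge_min le_max /h; apply/andP; split; apply/orP; [left|right]; rewrite /M in a1 a2 a3 a4 *; lra.
have [g hg] := choice fixp.
pose f x := x + d x *: e.
pose psi y := y - g y *: e.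
have inj x y : `|x - y| <= 2 * `|f x - f y|.
  have : `|x - y| <= `|f x - f y| + 2^-1 * `|x - y|.
    rewrite {1}(_ : x - y = f x - f y - (d x - d y) *: e); last first.
      by rewrite /f scalerBl opprD addrACA addrK.
    apply: le_trans (ler_normB _ _) _; rewrite lerD2l normrZ.
    apply: le_trans (ler_wpM2r (normr_ge0 _) (ld x y)) _.
    by rewrite mulrAC ler_wpM2r.
  lra.
have psiK : cancel psi f by move=> y; rewrite /f {2}/psi -hg subrK.
have fK : cancel f psi.
  move=> x; apply/eqP; rewrite -subr_eq0 -normr_eq0 eq_le normr_ge0 andbT.
  by apply: le_trans (inj _ _) _; rewrite psiK subrr normr0 mulr0.
have psilip x y : `|psi x - psi y| <= 2 * `|x - y|.
  by apply: le_trans (inj _ _) _; rewrite !psiK.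
have dd x := sm_differentiable x sd.
have de x : 2^-1 <= 1 + 'd d x e.
  have := lip_derive e ld (dd x) => /le_trans/(_ Ke).
  by rewrite ler_norml => /andP[h _]; lra.
have glip x y : `|g x - g y| <= 2 * K * `|x - y|.
  rewrite {1}hg (hg y); apply: le_trans (ld _ _) _.
  by rewrite (mulrC 2) -mulrA ler_wpM2l //; exact: psilip.
pose dg y v := (1 + 'd d (psi y) e)^-1 * 'd d (psi y) v.
have gdiff y : differentiable g y /\ 'd g y = dg y :> (V -> R).
  have lin_dg : linear (dg y).
    by move=> c u v; rewrite /dg linearP mulrDr; congr (_ + _); rewrite /GRing.scale /= mulrCA.
  pose dgM := GRing.isLinear.Build _ _ _ _ _ lin_dg.
  pose dgL : {linear V -> R} := HB.pack (dg y) dgM.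
  have dgc : continuous dgL.
    move=> v; apply: cvgM; first exact: cvg_cst.
    exact: diff_continuous.
  have E : g \o shift y = cst (g y) + dgL +o_ 0 id.
    apply/eqaddoP => eps eps0.
    have /eqaddoP hd := diff_locally (dd (psi y)).
    have c0 : 0 < eps / 4 by rewrite divr_gt0.
    have {hd} /nbhs_normP[r r0 hr] := hd _ c0.
    near=> h; rewrite !fctE /=.
    pose k := psi (h + y) - psi y.
    have kh : `|k| <= 2 * `|h|.
      by apply: le_trans (psilip _ _) _; rewrite addrK.
    have kr : `|k| < r.
      apply: le_lt_trans kh _; rewrite mulrC -ltr_pdivlMr //.
      near: h; apply/nbhs_normP; exists (r / 2) => /=; first exact: divr_gt0.
      by move=> z /=; rewrite sub0r normrN.
    have := hr k; rewrite /= sub0r normrN !fctE /= => /(_ kr) hk.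
    have {hk} := le_trans hk (ler_wpM2l (ltW c0) kh).
    rewrite /k subrK {1 2}/psi -!hg.
    have -> : psi (h + y) - psi y = h - (g (h + y) - g y) *: e.
      by rewrite /psi scalerBl !opprB (addrAC h) addrACA subrr addr0 -addrA (addrC (- _)).
    rewrite linearB linearZ /=.
    rewrite /dg; set A := 'd d _ h; set B := 'd d _ e.
    have B0 := de (psi y); rewrite -/B in B0.
    have Bp : 0 < 1 + B by lra.
    have -> : g (h + y) - (g y + (1 + B)^-1 * A) =
       (1 + B)^-1 * (g (h + y) - (g y + (A - (g (h + y) - g y) *: B))).
      by rewrite /GRing.scale /=; field; rewrite gt_eqF.
    move=> H; rewrite normrM gtr0_norm ?invr_gt0 // mulrC ler_pdivrMr //.
    apply: le_trans H _.
    have p0 : 0 <= eps * `|h| by rewrite mulr_ge0 // ltW.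
    have -> : eps / 4 * (2 * `|h|) = eps * `|h| * 2^-1 by field.
    by rewrite ler_wpM2l //; lra.
  have E2 : 'd g y = dgL :> (V -> R) by exact: diff_unique.
  split; last by rewrite E2.
  by apply/diff_locallyP; rewrite E2; split.
have sg : sm g.
  move=> k; elim: k => [|k IH].
    by apply: (lip_continuous (K := 2 * K)) => //; rewrite mulr_ge0.
  split=> [y|]; first by case: (gdiff y).
  rewrite [X in Sm k X](_ : _ = fun p => (1 + 'd d (psi p.1) e)^-1 * 'd d (psi p.1) p.2); last first.
    by apply/funext => p; case: (gdiff p.1) => _ ->.
  have sd2 := sm_tangent sd k.
  have spsi : Sm k (fun p : V * V => psi p.1).
    have s1 : Sm k psi.
      apply: SmD; first exact: Sm_id.
      rewrite (_ : (fun y => _) = fun y => g y *: (- e)); last by apply/funext => y; rewrite scalerN.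
      by apply: SmZ => //; exact: Sm_cst.
    exact: (Sm_comp s1 (@Sm_fst R k V V)).
  apply: SmM.
    apply: SmV => [p|]; first by rewrite gt_eqF //; apply: lt_le_trans (de _); rewrite invr_gt0.
    apply: SmD; first exact: Sm_cst.
    exact: (Sm_comp sd2 (Sm_pair spsi (@Sm_cst _ k _ V e))).
  exact: (Sm_comp sd2 (Sm_pair spsi (@Sm_snd R k V V))).
exists psi; split => //.
apply: smB; first exact: sm_id.
by apply: smZ => //; exact: sm_cst.
Unshelve. all: by end_near. Qed.
End Shear.

Section LocalInverse.
Context {R : realType}.

Lemma derive0_cst (f : R -> R) (r x0 x : R) : 
  (forall y, `|y - x0| <= r -> is_derive y 1 f 0) -> `|x - x0| <= r -> f x = f x0.
Proof.
move=> df xr; apply/eqP; rewrite -subr_eq0.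
have [h|/ltW h] := leP x0 x.
  have [|c _ ->] := @MVT_le R f (fun=> 0) x0 x h; last by rewrite mul0r.
  by move=> y /andP[y1 y2]; apply: df; rewrite ler_norml; move: xr; rewrite ler_norml; lra.
have [|c _ E] := @MVT_le R f (fun=> 0) x x0 h.
  by move=> y /andP[y1 y2]; apply: df; rewrite ler_norml; move: xr; rewrite ler_norml; lra.
by rewrite -opprB E mul0r oppr0.
Qed.

Lemma continuous_near (V : normedModType R) (f : V -> R) (x : V) (e : R) :
  continuous f -> 0 < e -> exists2 r : R, 0 < r & forall y, `|y - x| < r -> `|f y - f x| < e.
Proof.
move=> fc e0; have /cvgrPdist_lt /(_ e e0) /nbhs_normP[r r0 hr] := fc x.
by exists r => // y; rewrite distrC => /hr /=; rewrite distrC.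
Qed.

Lemma cutoff_zoom0 (r x : R) : 0 < r -> 3 * r <= `|x| -> cutoff (x / r) = 0.
Proof.
move=> r0 h; apply: cutoff0; rewrite normrM normfV (gtr0_norm r0) ler_pdivlMr //; lra.
Qed.

Lemma cutoff_zoom1 (r x : R) : 0 < r -> `|x| <= r -> cutoff (x / r) = 1.
Proof.
by move=> r0 h; apply: cutoff1; rewrite normrM normfV (gtr0_norm r0) ler_pdivrMr // mul1r.
Qed.

Lemma sm_affine (a b : R) : sm (fun s : R => (s - a) / b).
Proof. by apply: smM; [apply: smB; [exact: sm_id|exact: sm_cst]|exact: sm_cst]. Qed.

Lemma local_inverse (f : R -> R) (s0 : R) : sm f -> 'D_1 f s0 != 0 ->
  exists sigma : R -> R, exists r K : R, [/\ sm sigma, 0 < r, 0 <= K, lip K sigma &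
    forall s, `|s - s0| < r -> sigma (f s) = s].
Proof.
move=> sf; set c := 'D_1 f s0 => c0.
pose k s := 'D_1 f s / c - 1.
have sk : sm k.
  by apply: smB; [apply: smM; [exact: sm_derive|exact: sm_cst]|exact: sm_cst].
have k0 : k s0 = 0 by rewrite /k mulfV // subrr.
have h20 : 0 < 2^-1 :> R by rewrite invr_gt0.
have [eta eta0 heta] := continuous_near s0 (sm_continuous sk) h20.
pose r := eta / 3; have r0 : 0 < r by rewrite divr_gt0.
pose h s := cutoff ((s - s0) / r) * k s.
have sh : sm h by apply: smM => //; exact: (sm_comp sm_cutoff (sm_affine s0 r)).
have hb s : `|h s| <= 2^-1.
  rewrite /h; have [sl|sl] := ltP `|s - s0| eta.
    have := heta _ sl; rewrite k0 subr0 => /ltW h1.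
    have /andP[b0 b1] := cutoff_itv ((s - s0) / r).
    rewrite normrM (ger0_norm b0) -[2^-1]mul1r.
    exact: ler_pM.
  rewrite cutoff_zoom0 ?mul0r ?normr0 ?(ltW h20) //.
  by apply: le_trans sl; rewrite /r; lra.
have [H sH dH] := sm_primitive sh.
pose d s := H s - H s0.
have sd : sm d by apply: smB => //; exact: sm_cst.
have dd (s : R) : is_derive s 1 d (h s).
  by have := is_deriveB (dH s) (is_derive_cst (H s0) s 1); rewrite subr0.
have ld : lip 2^-1 d by move=> x y; exact: derive_bound dd hb.
have one : 2^-1 * `|1 : R| <= 2^-1 by rewrite normr1 mulr1.
have [g [sg gK _ lg]] := shear_inverse sd (ltW h20) ld one.
exists (fun x => g ((x - f s0) / c + s0)), r, (2 / `|c|); split => //.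
- apply: (sm_comp sg); apply: smD; [exact: sm_affine|exact: sm_cst].
- move=> x y; apply: le_trans (lg _ _) _.
  rewrite opprD addrACA subrr addr0 -mulrBl opprB addrA subrK normrM normfV.
  by rewrite mulrA mulrAC.
move=> s sr.
have E : f s / c - s - d s = f s0 / c - s0 - d s0.
  apply: (derive0_cst (f := fun s => f s / c - s - d s) (r := r)) (ltW sr) => y yr.
  have d1 := is_deriveMf (sm_is_derive y 1 sf) (is_derive_cst c^-1 y 1).
  apply: (is_derive_eq (is_deriveB (is_deriveB d1 (is_derive_id y 1)) (dd y))).
  by rewrite /h cutoff_zoom1 // /k mulr0 addr0 mul1r; exact: subrr.
have -> : (f s - f s0) / c + s0 = s + d s *: 1.
  rewrite /GRing.scale /= mulr1 mulrBl; move: E; rewrite {2}/d subrr; lra.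
exact: gK.
Qed.

End LocalInverse.

Section Links.
Context {R : realType}.

Lemma periodic_int (T : Type) (f : R -> T) : (forall s, f (s + 1) = f s) ->
  forall (m : int) s, f (s + m%:~R) = f s.
Proof.
move=> pf; have pn n s : f (s + n%:R) = f s.
  by elim: n s => [|n IH] s; rewrite ?addr0 // -natr1 addrA pf.
case=> n s; first exact: pn.
by rewrite NegzE mulrNz -[in RHS](subrK n.+1%:R s) pn.
Qed.

Definition lset n (L : 'I_n -> R -> 'rV[R]_3) := \bigcup_(i in setT) range (L i).

Lemma frac_itv (x a : R) : exists m : int, a <= x + m%:~R < a + 1.
Proof.
exists (- Num.floor (x - a)); rewrite mulrNz.
have := floor_itv (x - a) => /andP[h1 h2]; move: h1 h2; rewrite intrD /= => h1 h2.
by apply/andP; split; lra.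
Qed.

Lemma link_eq n (L : 'I_n -> R -> 'rV[R]_3) i j s u : link L ->
  L i s = L j u -> i = j /\ exists m : int, s = u + m%:~R.
Proof.
move=> [cL dL] E; have ij : i = j.
  apply/eqP/negPn/negP => nij; have := dL i j nij.
  move=> /seteqP[/(_ (L i s)) h _]; apply: h; split; first by exists s.
  by exists u.
subst j; split=> //; have [_ [per [inj _]]] := cL i.
have [m hm] := frac_itv s 0; have [p hp] := frac_itv u 0.
rewrite add0r in hm hp.
have : s + m%:~R = u + p%:~R by apply: inj => //; rewrite !periodic_int.
exists (p - m); rewrite intrD mulrNz; lra.
Qed.

Lemma segment_away (f : R -> 'rV[R]_3) (X : 'rV[R]_3) (a b : R) : continuous f ->
  (forall s, a <= s <= b -> f s <> X) ->
  exists2 r : R, 0 < r & forall s, a <= s <= b -> r <= `|f s - X|.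
Proof.
move=> fc nX; have [ab|ab] := leP a b; last first.
  by exists 1 => // s /andP[h1 h2]; have := le_trans h1 h2; rewrite leNgt ab.
have nc : {within `[a, b], continuous (fun s => `|f s - X|)}.
  apply: continuous_subspaceT => x; apply: cvg_norm; apply: cvgB; first exact: fc.
  exact: cvg_cst.
have [c cab H] := EVT_min ab nc.
exists `|f c - X|; last by move=> s sab; apply: H; rewrite in_itv.
rewrite normr_gt0 subr_eq0; apply/eqP; apply: nX.
by move: cab; rewrite in_itv.
Qed.

Lemma uniform_radius n (P : 'I_n -> R -> Prop) :
  (forall i r r', 0 < r' <= r -> P i r -> P i r') ->
  (forall i, exists2 r, 0 < r & P i r) -> exists2 r, 0 < r & forall i, P i r.
Proof.
move=> mono H.
have H' i : exists r : R, 0 < r /\ P i r by have [r r0 Pr] := H i; exists r.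
have [r hr] := choice H'.
have m0 : 0 < \big[Num.min/1]_i r i.
  by apply: lt_bigmin => // i _; have [] := hr i.
exists (\big[Num.min/1]_i r i) => // i.
have [ri Pi] := hr i.
apply: mono Pi; rewrite m0 /=.
exact: bigmin_le.
Qed.

Lemma arc_nbhs n (L : 'I_n -> R -> 'rV[R]_3) i0 s0 r : link L -> 0 < r ->
  exists2 rho : R, 0 < rho & forall Y, lset L Y -> `|Y - L i0 s0| < rho ->
    exists2 s, `|s - s0| < r & Y = L i0 s.
Proof.
move=> lL r0; have [cL _] := lL.
have Lc i : continuous (L i) by have [sL _] := cL i; apply: sm_continuous; exact: smooth_sm.
have per i (m : int) s : L i (s + m%:~R) = L i s.
  by have [_ [pL _]] := cL i; apply: periodic_int.
have [rho rho0 h] : exists2 rho : R, 0 < rho & forall i s,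
   (i != i0 -> s0 - r / 2 <= s <= s0 - r / 2 + 1 -> rho <= `|L i s - L i0 s0|) /\
   (i = i0 -> s0 + r / 2 <= s <= s0 - r / 2 + 1 -> rho <= `|L i s - L i0 s0|).
  apply: (@uniform_radius n (fun i rho => forall s,
   (i != i0 -> s0 - r / 2 <= s <= s0 - r / 2 + 1 -> rho <= `|L i s - L i0 s0|) /\
   (i = i0 -> s0 + r / 2 <= s <= s0 - r / 2 + 1 -> rho <= `|L i s - L i0 s0|))).
    move=> i r1 r2 /andP[r20 r21] H s; have [H1 H2] := H s; split=> a b.
      exact: (le_trans r21 (H1 a b)).
    exact: (le_trans r21 (H2 a b)).
  move=> i; have [ii0|nii0] := eqVneq i i0.
    have [|rho rho0 h] := @segment_away (L i) (L i0 s0) (s0 + r / 2) (s0 - r / 2 + 1) (Lc i).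
      move=> s /andP[h1 h2] /(link_eq lL)[_ [m E]].
      have m0 : (0 : R) < m%:~R by lra.
      have m1 : (m%:~R : R) < 1 by lra.
      by move: m0 m1; rewrite ltr0z ltrz1 gtz0_ge1 ltNge => ->.
    by exists rho => // s; split=> // _; exact: h.
  have [|rho rho0 h] := @segment_away (L i) (L i0 s0) (s0 - r / 2) (s0 - r / 2 + 1) (Lc i).
    by move=> s _ /(link_eq lL)[/eqP]; rewrite (negPf nii0).
  by exists rho => // s; split=> [_|E]; [exact: h|rewrite E eqxx in nii0].
exists rho => // Y [i _ [s _ <-]].
have [m /andP[m1 m2]] := frac_itv s (s0 - r / 2).
rewrite -(per i m s) => hY.
have [H1 H2] := h i (s + m%:~R).
have ii0 : i = i0.
  by apply/eqP/negPn/negP => /H1 H; move: H; rewrite m1 (ltW m2) => /(_ isT); rewrite leNgt hY.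
subst i; exists (s + m%:~R) => //.
have {H1} H := H2 erefl.
have sr : s + m%:~R < s0 + r / 2.
  rewrite ltNge; apply/negP => h3; move: H; rewrite h3 (ltW m2) => /(_ isT).
  by rewrite leNgt hY.
by rewrite ltr_norml; apply/andP; split; lra.
Qed.

Lemma lset_compact n (L : 'I_n -> R -> 'rV[R]_3) : link L -> compact (lset L).
Proof.
move=> [cL _].
have -> : lset L = \bigcup_(i in [set` 'I_n]) (L i @` `[0, 1]).
  apply/seteqP; split=> [Y [i _ [s _ <-]]|Y [i _ [s _ <-]]]; exists i => //.
  have [m /andP[m1 m2]] := frac_itv s 0; rewrite add0r in m2.
  exists (s + m%:~R); first by rewrite /= in_itv /= m1 ltW.
  by have [_ [pL _]] := cL i; exact: periodic_int.
rewrite bigcup_pred; apply: bigsetU_compact => i _.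
apply: continuous_compact; last exact: segment_compact.
by apply: continuous_subspaceT; have [sL _] := cL i; apply: sm_continuous; exact: smooth_sm.
Qed.

Lemma rV_norm_coord n (x : 'rV[R]_n.+1) j : `|x 0 j| <= `|x|.
Proof. by rewrite [leRHS]/Num.Def.normr/= mx_normrE; exact: (le_bigmax _ _ (0, j)). Qed.

Lemma rV_norm_le n (x : 'rV[R]_n.+1) (r : R) : 0 <= r ->
  (forall j, `|x 0 j| <= r) -> `|x| <= r.
Proof.
move=> r0 h; rewrite [leLHS]/Num.Def.normr/= mx_normrE (bigmax_le _ r0)//= => -[i j] _.
by rewrite ord1; exact: h.
Qed.

Definition bounded_lip (V : normedModType R) (K : R) (f : V -> R) :=
  (forall x, `|f x| <= K) /\ lip K f.

Lemma bounded_lip_ge0 (V : normedModType R) (K : R) (f : V -> R) :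
  bounded_lip K f -> 0 <= K.
Proof. by move=> [/(_ 0) h _]; apply: le_trans h. Qed.

Lemma bounded_lipW (V : normedModType R) (K K' : R) (f : V -> R) :
  K <= K' -> bounded_lip K f -> bounded_lip K' f.
Proof.
move=> KK [h1 h2]; split=> [x|x y]; first exact: le_trans (h1 x) KK.
by apply: le_trans (h2 x y) _; rewrite ler_wpM2r.
Qed.

Lemma bounded_lipD (V : normedModType R) (K K' : R) (f g : V -> R) :
  bounded_lip K f -> bounded_lip K' g -> bounded_lip (K + K') (fun x => f x + g x).
Proof.
move=> [f1 f2] [g1 g2]; split=> [x|x y].
  by apply: le_trans (ler_normD _ _) _; apply: lerD.
rewrite opprD addrACA mulrDl.
by apply: le_trans (ler_normD _ _) _; apply: lerD; [exact: f2|exact: g2].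
Qed.

Lemma bounded_lipN (V : normedModType R) (K : R) (f : V -> R) :
  bounded_lip K f -> bounded_lip K (fun x => - f x).
Proof.
move=> [f1 f2]; split=> [x|x y]; first by rewrite normrN.
by rewrite -opprD normrN; exact: f2.
Qed.

Lemma bounded_lipM (V : normedModType R) (K K' : R) (f g : V -> R) :
  bounded_lip K f -> bounded_lip K' g -> bounded_lip (2 * K * K') (fun x => f x * g x).
Proof.
move=> bf bg; have K0 := bounded_lip_ge0 bf; have K'0 := bounded_lip_ge0 bg.
have [[f1 f2] [g1 g2]] := (bf, bg); split=> [x|x y].
  have : `|f x * g x| <= K * K' by rewrite normrM ler_pM.
  move=> /le_trans; apply; rewrite -mulrA; have : 0 <= K * K' by rewrite mulr_ge0.
  lra.
have -> : f x * g x - f y * g y = (f x - f y) * g x + f y * (g x - g y) by ring.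
apply: le_trans (ler_normD _ _) _; rewrite !normrM.
have : `|f x - f y| * `|g x| <= K * `|x - y| * K' by apply: ler_pM => //; exact: f2.
have : `|f y| * `|g x - g y| <= K * (K' * `|x - y|) by apply: ler_pM => //; exact: g2.
lra.
Qed.

Definition box_cutoff (X : 'rV[R]_3) (r : R) (Y : 'rV[R]_3) : R :=
  cutoff ((Y 0 ax0 - X 0 ax0) / r) * cutoff ((Y 0 ax1 - X 0 ax1) / r)
  * cutoff ((Y 0 ax2 - X 0 ax2) / r).

Lemma ax_cases (j : 'I_3) : [\/ j = ax0, j = ax1 | j = ax2].
Proof.
case: j => -[|[|[|//]]] h; [apply: Or31|apply: Or32|apply: Or33]; exact: val_inj.
Qed.

Lemma box_cutoff0 X r Y : 0 < r -> 3 * r <= `|Y - X| -> box_cutoff X r Y = 0.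
Proof.
move=> r0 h; rewrite /box_cutoff.
have [h0|h0] := leP (3 * r) `|Y 0 ax0 - X 0 ax0|.
  by rewrite (cutoff_zoom0 r0 h0) !mul0r.
have [h1|h1] := leP (3 * r) `|Y 0 ax1 - X 0 ax1|.
  by rewrite (cutoff_zoom0 r0 h1) mulr0 mul0r.
have [h2|h2] := leP (3 * r) `|Y 0 ax2 - X 0 ax2|.
  by rewrite (cutoff_zoom0 r0 h2) mulr0.
exfalso; move: h; apply/negP; rewrite -ltNge.
pose m := Num.max `|Y 0 ax0 - X 0 ax0| (Num.max `|Y 0 ax1 - X 0 ax1| `|Y 0 ax2 - X 0 ax2|).
have : m < 3 * r by rewrite /m !gt_max h0 h1.
apply: le_lt_trans; apply: rV_norm_le.
  by rewrite /m le_max normr_ge0.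
by move=> j; rewrite !mxE /m !le_max; case: (ax_cases j) => ->; rewrite lexx ?orbT.
Qed.

Lemma box_cutoff1 X r Y : 0 < r -> `|Y - X| <= r -> box_cutoff X r Y = 1.
Proof.
move=> r0 h.
have P j : cutoff ((Y 0 j - X 0 j) / r) = 1.
  apply: cutoff_zoom1 => //; apply: le_trans h.
  by have := rV_norm_coord (Y - X) j; rewrite !mxE.
by rewrite /box_cutoff !P !mulr1.
Qed.

Lemma sm_box_cutoff X r : sm (box_cutoff X r).
Proof.
have P j : sm (fun Y : 'rV[R]_3 => cutoff ((Y 0 j - X 0 j) / r)).
  apply: (sm_comp sm_cutoff); apply: (sm_comp (sm_affine (X 0 j) r)).
  exact: sm_coord.
by apply: smM => //; exact: smM.
Qed.

Lemma box_cutoff_lip X r : 0 < r -> exists K, bounded_lip K (box_cutoff X r).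
Proof.
move=> r0; have [K K0 hK] := @cutoff_lipschitz R.
have P j : bounded_lip (1 + K / r) (fun Y : 'rV[R]_3 => cutoff ((Y 0 j - X 0 j) / r)).
  have Kr : 0 <= K / r by rewrite divr_ge0 // ltW.
  split=> [x|x y].
    have /andP[c0 c1] := cutoff_itv ((x 0 j - X 0 j) / r).
    by rewrite ger0_norm //; lra.
  apply: le_trans (hK _ _) _.
  rewrite -mulrBl opprB addrA subrK normrM normfV (gtr0_norm r0) mulrCA mulrC.
  have h : `|x 0 j - y 0 j| <= `|x - y|.
    by have := rV_norm_coord (x - y) j; rewrite !mxE.
  have := normr_ge0 (x - y); have := ler_wpM2l Kr h; rewrite mulrDl mul1r; lra.
eexists; exact: (bounded_lipM (bounded_lipM (P _) (P _)) (P _)).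
Qed.

End Links.

Section LinkPerturbation.
Context {R : realType}.

Definition small_datum n (e : R) (d : 'I_n -> R -> R) :=
  forall i, [/\ sm (d i), forall s, d i (s + 1) = d i s, forall s, `|d i s| <= e &
     forall s, `|'D_1 (d i) s| <= e].

Definition extends_on n (L : 'I_n -> R -> 'rV[R]_3) (A : set 'rV[R]_3) (K : R) :=
  forall e d, 0 <= e -> small_datum e d ->
  exists delta : 'rV[R]_3 -> R, [/\ sm delta, bounded_lip (K * e) delta &
     forall i s, A (L i s) -> delta (L i s) = d i s].

Lemma extends_step n (L : 'I_n -> R -> 'rV[R]_3) (X0 : 'rV[R]_3) : link L -> lset L X0 ->
  exists2 r : R, 0 < r & forall A, (exists K, extends_on L A K) ->
    exists K, extends_on L (A `|` ball X0 r) K.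
Proof.
move=> lL [i0 _ [s0 _ <-]]; have [cL _] := lL.
have [sL [_ [_ L']]] := cL i0.
have {}sL := smooth_sm sL.
have [l hl] : exists l, 'D_1 (fun s => L i0 s 0 l) s0 != 0.
  apply: contrapT => h; have /negP := L' s0; apply; apply/eqP.
  rewrite derive_mx; last by apply/diff_derivable; exact: sm_differentiable.
  apply/rowP => l; rewrite !mxE; apply: contrapT => /eqP h'; apply: h.
  by exists l.
have sLl : sm (fun s => L i0 s 0 l) := sm_comp (sm_coord l) sL.
have [sigma [r0 [Ks [ss r00 Ks0 ls sK]]]] := local_inverse sLl hl.
have [rho rho0 hrho] := arc_nbhs i0 s0 lL r00.
have rh0 : 0 < rho / 3 by rewrite divr_gt0.
exists (rho / 3) => // A [K hK].
have [Kb0 bb] := box_cutoff_lip (L i0 s0) rh0.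
set X := L i0 s0 in hrho bb *.
pose K1 := 1 + Ks + K.
exists (K + 2 * Kb0 * K1) => e d e0 hd.
have [delta [sd bd cd]] := hK e d e0 hd.
have [sdi pdi bdi ddi] := hd i0.
pose u (Y : 'rV[R]_3) := d i0 (sigma (Y 0 l)) - delta Y.
have bu : bounded_lip (K1 * e) u.
  have -> : K1 * e = (1 + Ks) * e + K * e by rewrite /K1; ring.
  apply: bounded_lipD; last exact: bounded_lipN.
  split=> [x|x y].
    by apply: le_trans (bdi _) _; rewrite mulrDl mul1r lerDl mulr_ge0.
  have h1 := derive_bound (sigma (x 0 l)) (sigma (y 0 l)) (fun s => sm_is_derive s 1 sdi) ddi.
  apply: le_trans h1 _.
  have h : `|x 0 l - y 0 l| <= `|x - y|.
    by have := rV_norm_coord (x - y) l; rewrite !mxE.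
  have h2 := le_trans (ls (x 0 l) (y 0 l)) (ler_wpM2l Ks0 h).
  have := ler_wpM2l e0 h2; have := mulr_ge0 e0 (normr_ge0 (x - y)); lra.
exists (fun Y => delta Y + box_cutoff X (rho / 3) Y * u Y); split.
- apply: smD => //; apply: smM; first exact: sm_box_cutoff.
  apply: smB => //; apply: (sm_comp sdi); apply: (sm_comp ss); exact: sm_coord.
- rewrite mulrDl; apply: bounded_lipD => //.
  have -> : 2 * Kb0 * K1 * e = 2 * Kb0 * (K1 * e) by rewrite !mulrA.
  exact: bounded_lipM.
move=> i s hA.
have lY : lset L (L i s) by exists i => //; exists s.
have near_ok : `|L i s - X| < rho -> u (L i s) = d i s - delta (L i s).
  move=> h; have [s' s'r E] := hrho _ lY h.
  have [ii [m sm']] := link_eq lL E.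
  by rewrite /u E sK // sm' ii (periodic_int pdi).
have [h|h] := ltP `|L i s - X| rho; last first.
  rewrite box_cutoff0 //; last by apply: le_trans h; lra.
  rewrite mul0r addr0; apply: cd; case: hA => // hb.
  have : `|L i s - X| < rho / 3 by move: hb; rewrite -ball_normE /= distrC.
  lra.
rewrite near_ok //; case: hA => hb.
  by rewrite cd // subrr mulr0 addr0.
rewrite box_cutoff1 // ?mul1r; first by rewrite addrC subrK.
by move: hb; rewrite -ball_normE /= distrC => /ltW.
Qed.

Lemma extends_link n (L : 'I_n -> R -> 'rV[R]_3) : link L ->
  exists2 K, 0 <= K & extends_on L setT K.
Proof.
move=> lL.
have [K hK] : exists K, extends_on L (lset L) K.
  apply: (compact_ind (P := fun A => exists K, extends_on L A K)).
  - exact: lset_compact.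
  - exists 0 => e d e0 hd; exists (fun=> 0); split=> //; first exact: sm_cst.
    by rewrite mul0r; split=> [x|x y]; rewrite ?subrr normr0 ?mul0r.
  - move=> A B BA [K hK]; exists K => e d e0 hd.
    by have [delta [? ? h]] := hK e d e0 hd; exists delta; split=> // i s /BA; exact: h.
  - by move=> X; exact: extends_step.
exists `|K| => // e d e0 hd.
have [delta [sd bd cd]] := hK e d e0 hd; exists delta; split=> //.
  by apply: bounded_lipW bd; rewrite ler_wpM2r // ler_norm.
by move=> i s _; apply: cd; exists i => //; exists s.
Qed.

Lemma displace_inverse (V : normedModType R) (Phi g : V -> V) (M K : R) (a : V -> R) (e : V) :
  sm g -> cancel Phi g -> cancel g Phi -> (forall x y, `|g x - g y| <= M * `|x - y|) ->
  0 <= M -> sm a -> 0 <= K -> lip K a -> K * M * `|e| <= 2^-1 ->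
  exists g' : V -> V, [/\ sm g', cancel (fun x => Phi x + a x *: e) g',
    cancel g' (fun x => Phi x + a x *: e) & forall x y, `|g' x - g' y| <= M * 2 * `|x - y|].
Proof.
move=> sg PhiK gK lg M0 sa K0 la KMe.
have lag : lip (K * M) (a \o g).
  move=> x y; apply: le_trans (la _ _) _; rewrite -mulrA.
  exact: ler_wpM2l.
have [h [sh h1 h2 lh]] := shear_inverse (sm_comp sa sg) (mulr_ge0 K0 M0) lag KMe.
exists (g \o h); split.
- exact: sm_comp.
- by move=> x; have := h1 (Phi x); rewrite /= PhiK => ->.
- by move=> x; rewrite /= gK; have := h2 x.
- move=> x y; apply: le_trans (lg _ _) _; rewrite -mulrA.
  exact: ler_wpM2l.
Qed.

Definition displace (d : 'I_3 -> 'rV[R]_3 -> R) (t : R) (x : 'rV[R]_3) :=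
  x + (t * d ax0 x) *: evec ax0 + (t * d ax1 x) *: evec ax1 + (t * d ax2 x) *: evec ax2.

Lemma displace_coord d t x j : displace d t x 0 j = x 0 j + t * d j x.
Proof.
rewrite /displace /evec !mxE /=.
by case: (ax_cases j) => ->; rewrite /= ?mulr1 ?mulr0 ?addr0.
Qed.

Lemma evec_norm (i : 'I_3) : `|evec i : 'rV[R]_3| <= 1.
Proof.
apply: rV_norm_le => // j; rewrite mxE /=.
by case: (j == i); rewrite ?normr1 ?normr0.
Qed.

Definition sm_isotopy (H : R -> 'rV[R]_3 -> 'rV[R]_3) :=
  [/\ sm (fun p : R * 'rV[R]_3 => H p.1 p.2), forall x, H 0 x = x &
    forall t, 0 <= t <= 1 -> exists G, [/\ sm G, cancel (H t) G & cancel G (H t)]].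

Lemma displace_isotopy (d : 'I_3 -> 'rV[R]_3 -> R) :
  (forall i, sm (d i)) -> (forall i, lip 8^-1 (d i)) -> sm_isotopy (displace d).
Proof.
move=> sd ld; split=> [|x|t /andP[t0 t1]].
- have s1 i : sm (fun p : R * 'rV[R]_3 => (p.1 * d i p.2) *: evec i).
    apply: smZ; last exact: sm_cst.
    by apply: smM; [exact: sm_fst|exact: (sm_comp (sd i) (@sm_snd R _ _))].
  by apply: smD => //; apply: smD => //; apply: smD => //; exact: sm_snd.
- by rewrite /displace !mul0r !scale0r !addr0.
have sa i : sm (fun x => t * d i x) by apply: smM => //; exact: sm_cst.
have la i : lip 8^-1 (fun x => t * d i x).
  move=> x y; rewrite -mulrBr normrM (ger0_norm t0).
  rewrite -[leRHS]mul1r; apply: ler_pM => //; exact: ld.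
have K0 : 0 <= 8^-1 :> R by rewrite invr_ge0.
have lid (x y : 'rV[R]_3) : `|id x - id y| <= 1 * `|x - y| by rewrite mul1r.
have H i (c : R) : 0 <= c -> 8^-1 * c <= 2^-1 -> 8^-1 * c * `|evec i : 'rV[R]_3| <= 2^-1.
  move=> c0 hc; rewrite -[leRHS]mulr1; apply: ler_pM => //; last exact: evec_norm.
  by rewrite mulr_ge0.
have c1 : 0 <= 1 :> R by [].
have c2 : 0 <= 1 * 2 :> R by lra.
have c4 : 0 <= 1 * 2 * 2 :> R by lra.
have H1 := H ax0 1 c1 ltac:(lra).
have H2 := H ax1 (1 * 2) c2 ltac:(lra).
have H3 := H ax2 (1 * 2 * 2) c4 ltac:(lra).
have [g1 [sg1 a1 b1 l1]] := displace_inverse (sm_id _) (fun=> erefl) (fun=> erefl) lid c1 (sa ax0) K0 (la ax0) H1.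
have [g2 [sg2 a2 b2 l2]] := displace_inverse sg1 a1 b1 l1 c2 (sa ax1) K0 (la ax1) H2.
have [g3 [sg3 a3 b3 l3]] := displace_inverse sg2 a2 b2 l2 c4 (sa ax2) K0 (la ax2) H3.
by exists g3.
Qed.

Lemma link_perturbation n (L : 'I_n -> R -> 'rV[R]_3) : link L ->
  exists2 e : R, 0 < e & forall C : 'I_n -> R -> 'rV[R]_3,
    (forall i, sm (C i)) -> (forall i s, C i (s + 1) = C i s) ->
    (forall i s j, `|C i s 0 j - L i s 0 j| <= e) ->
    (forall i s j, `|'D_1 (fun s => C i s 0 j) s - 'D_1 (fun s => L i s 0 j) s| <= e) ->
    exists H, sm_isotopy H /\ forall i s, H 1 (L i s) = C i s.
Proof.
move=> lL; have [K K0 hK] := extends_link lL.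
have K1 : 0 < 8 * (K + 1) by lra.
exists (8 * (K + 1))^-1; first by rewrite invr_gt0.
set e := _^-1; have e0 : 0 < e by rewrite invr_gt0.
move=> C sC pC bC dC.
have [cL _] := lL.
have sL i : sm (L i) by have [sL _] := cL i; exact: smooth_sm.
have hd j : small_datum e (fun i s => C i s 0 j - L i s 0 j).
  move=> i.
  have sCj : sm (fun s => C i s 0 j) := sm_comp (sm_coord j) (sC i).
  have sLj : sm (fun s => L i s 0 j) := sm_comp (sm_coord j) (sL i).
  split=> // [|s|s]; first exact: smB.
    by rewrite pC; have [_ [-> _]] := cL i.
  by rewrite deriveB //; exact: diff_derivable (sm_differentiable _ _).
have [dl hdl] := choice (fun j => hK e _ (ltW e0) (hd j)).
exists (displace dl); split.
  apply: displace_isotopy => j; have [sdj [_ ldj] _] := hdl j => //.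
  move=> x y; apply: le_trans (ldj x y) _; apply: ler_wpM2r => //.
  rewrite /e ler_pdivrMr //; lra.
move=> i s; apply/rowP => j; have [_ _ h] := hdl j.
by rewrite displace_coord h // mul1r addrC subrK.
Qed.

Lemma sm_isotopy_translate H (c : 'rV[R]_3) : sm_isotopy H ->
  ambient_isotopy (fun t x => H t x + t *: c).
Proof.
move=> [sH H0 Hinv]; split; last split.
- apply: sm_smooth; apply: smD => //.
  by apply: smZ; [exact: sm_fst|exact: sm_cst].
- by move=> x; rewrite H0 scale0r addr0.
move=> t ht; have [G [sG GK KG]] := Hinv t ht.
exists (fun y => G (y - t *: c)); split; last split.
- apply: sm_smooth; apply: (sm_comp sG); apply: smB; [exact: sm_id|exact: sm_cst].
- by move=> x; rewrite addrK GK.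
- by move=> y; rewrite KG subrK.
Qed.

End LinkPerturbation.

Section Spline.
Context {R : realType}.

Let A (t : R) : R := step (10 * t - 1).

Definition ramp (t : R) : R := A t * A (1 - t) * t + (1 - A (1 - t)).

Let A0 t : t <= 10^-1 -> A t = 0.
Proof. by move=> h; apply: step_le0; lra. Qed.
Let A1 t : 5^-1 <= t -> A t = 1.
Proof. by move=> h; apply: step_ge1; lra. Qed.
Let AI t : 0 <= A t <= 1. Proof. exact: step_itv. Qed.

Lemma sm_ramp : sm ramp.
Proof.
have sA : sm A.
  apply: (sm_comp sm_step); apply: smB; last exact: sm_cst.
  by apply: smM; [exact: sm_cst|exact: sm_id].
have sA1 : sm (fun t : R => A (1 - t)).
  by apply: (sm_comp sA); apply: smB; [exact: sm_cst|exact: sm_id].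
apply: smD; last by apply: smB => //; exact: sm_cst.
by apply: smM; [exact: smM|exact: sm_id].
Qed.

Lemma ramp_left t : t <= 5^-1 -> ramp t = A t * t.
Proof. by move=> h; rewrite /ramp (A1 (t := 1 - t)) ?mulr1 ?subrr ?addr0 //; lra. Qed.

Lemma ramp_sym t : ramp t + ramp (1 - t) = 1.
Proof.
rewrite /ramp; have -> : 1 - (1 - t) = t by ring.
have : (1 - A t) * (1 - A (1 - t)) = 0.
  have [h|h] := leP 5^-1 t; first by rewrite A1 // subrr mul0r.
  by rewrite mulrC A1 ?subrr ?mul0r //; lra.
lra.
Qed.

Lemma ramp0 t : t <= 10^-1 -> ramp t = 0.
Proof. by move=> h; rewrite ramp_left ?A0 ?mul0r //; lra. Qed.

Lemma ramp_mid t : 5^-1 <= t <= 4 / 5 -> ramp t = t.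
Proof.
by move=> /andP[h1 h2]; rewrite /ramp !A1 ?mul1r ?subrr ?addr0 //; lra.
Qed.

Lemma ramp_le t : 0 <= t -> t <= 5^-1 -> 0 <= ramp t <= 5^-1.
Proof.
move=> t0 t5; rewrite ramp_left //; have /andP[a0 a1] := AI t.
by rewrite mulr_ge0 //=; apply: le_trans t5; rewrite ler_piMl.
Qed.

Lemma ramp_itv t : 0 <= ramp t <= 1.
Proof.
wlog h : t / t <= 2^-1.
  move=> H; have [h|h] := leP t 2^-1; first exact: H.
  have h1 : 1 - t <= 2^-1 by lra.
  by have /andP[] := H _ h1; have := ramp_sym t; lra.
have [h0|h0] := leP t 0; first by rewrite ramp0 ?lexx ?ler01 //; lra.
have [h5|h5] := leP t 5^-1; first by have := ramp_le (ltW h0) h5; lra.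
by rewrite ramp_mid; [lra|lra].
Qed.

Lemma ramp_mid_inv t : 2 / 9 <= ramp t <= 7 / 9 -> 5^-1 < t < 4 / 5.
Proof.
have P u : u <= 5^-1 -> ramp u <= 5^-1.
  move=> h; have [h0|h0] := leP u 0; first by rewrite ramp0 ?invr_ge0 //; lra.
  by have /andP[] := ramp_le (ltW h0) h.
move=> /andP[h1 h2]; rewrite !ltNge; apply/andP; split; apply/negP => h.
  by have := P _ h; lra.
have h' : 1 - t <= 5^-1 by lra.
by have := P _ h'; have := ramp_sym t; lra.
Qed.

Lemma ramp_primitive : exists T : R -> R, [/\ sm T, forall t : R, is_derive t 1 T (ramp t),
  forall t, t <= 10^-1 -> T t = 0, forall t, 9 / 10 <= t -> T t = t - 2^-1 &
  exists c, forall t, 5^-1 <= t <= 4 / 5 -> T t = t ^+ 2 / 2 + c].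
Proof.
have [T0 sT0 dT0] := sm_primitive sm_ramp.
pose T t := T0 t - T0 0.
have sT : sm T by apply: smB => //; exact: sm_cst.
have dT (t : R) : is_derive t 1 T (ramp t).
  by have := is_deriveB (dT0 t) (is_derive_cst (T0 0) t 1); rewrite subr0.
have cst_on (f : R -> R) (a b x y : R) : (forall z : R, a <= z <= b -> is_derive z 1 f 0) ->
    a <= x <= b -> a <= y <= b -> f x = f y.
  move=> df hx hy; wlog xy : x y hx hy / x <= y.
    by move=> H; case: (leP x y) => [/H->|/ltW/H->].
  have [|c _ E] := @MVT_le R f (fun=> 0) x y xy; last by lra.
  by move=> z hz; apply: df; lra.
have T_0 t : t <= 10^-1 -> T t = 0.
  move=> h; have -> : 0 = T 0 by rewrite /T subrr.
  apply: (cst_on T (Num.min t 0) 10^-1); last 2 first.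
  - by rewrite ge_min lexx h.
  - by rewrite ge_min lexx orbT; lra.
  by move=> z /andP[_ hz]; rewrite -(ramp0 hz).
have T_s t : T t = t - 2^-1 + T (1 - t).
  have dS (z : R) : is_derive z 1 (fun z : R => T z - z - T (1 - z)) 0.
    have d1 : is_derive z 1 (fun z : R => 1 - z) (- 1).
      by have := is_deriveB (is_derive_cst (1 : R) z (1 : R)) (is_derive_id z 1); rewrite sub0r.
    apply: (is_derive_eq (is_deriveB (is_deriveB (dT z) (is_derive_id z 1)) (is_derive_compf (g := fun z : R => 1 - z) (dT (1 - z)) d1))).
    have := ramp_sym z; lra.
  have := cst_on _ (Num.min t 2^-1) (Num.max t 2^-1) t 2^-1 (fun z _ => dS z).
  rewrite /= !ge_min !le_max !lexx !orbT => /(_ isT isT).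
  have -> : 1 - 2^-1 = 2^-1 :> R by lra.
  lra.
exists T; split => //.
  by move=> t h; rewrite T_s T_0 ?addr0 //; lra.
exists (T 5^-1 - 5^-1 ^+ 2 / 2) => t ht.
have dS (z : R) : 5^-1 <= z <= 4 / 5 -> is_derive z 1 (fun z : R => T z - z ^+ 2 / 2) 0.
  move=> hz; have d2 := is_deriveMf (is_deriveXf 2 (is_derive_id z 1)) (is_derive_cst (2^-1 : R) z 1).
  apply: (is_derive_eq (is_deriveB (dT z) d2)).
  by rewrite ramp_mid //= mulr0 addr0 expr1 mulr1; lra.
have := cst_on _ _ _ t 5^-1 dS ht; rewrite lexx => h.
have := h ltac:(lra); lra.
Qed.

Section Pieces.
Variables (T : R -> R).
Hypothesis sT : sm T.
Hypothesis dT : forall t : R, is_derive t 1 T (ramp t).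
Hypothesis T0 : forall t, t <= 10^-1 -> T t = 0.
Hypothesis T1 : forall t, 9 / 10 <= t -> T t = t - 2^-1.

(* Through the midpoints of the polygon with vertices a, b, c: affine near both
   ends, and exactly quadratic in the middle. *)
Definition piece (a b c t : R) := (a + b) / 2 + (b - a) * t + (c - 2 * b + a) * T t.

Lemma piece_overlap (a b c d t : R) : `|t| <= 10^-1 ->
  piece a b c (t + 1) = piece b c d t.
Proof.
rewrite ler_norml => /andP[h1 h2]; rewrite /piece T1 ?(T0 (t := t)) //; last lra.
by field.
Qed.

Lemma sm_piece a b c : sm (piece a b c).
Proof.
apply: smD; last by apply: smM => //; exact: sm_cst.
apply: smD; first exact: sm_cst.
by apply: smM; [exact: sm_cst|exact: sm_id].
Qed.

Lemma is_derive_piece (a b c t : R) :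
  is_derive t 1 (piece a b c) ((1 - ramp t) * (b - a) + ramp t * (c - b)).
Proof.
have d1 := is_deriveMf (is_derive_cst (b - a) t 1) (is_derive_id t 1).
have d2 := is_deriveMf (is_derive_cst (c - 2 * b + a) t 1) (dT t).
have d3 := is_deriveD (is_deriveD (is_derive_cst ((a + b) / 2) t 1) d1) d2.
by apply: (is_derive_eq d3); rewrite /cst /=; ring.
Qed.

Variable Z : int -> R.

Definition spline (x : R) :=
  let k := Num.floor x in piece (Z k) (Z (k + 1)) (Z (k + 2)) (x - k%:~R).

Lemma splineE (k : int) x : - 10^-1 <= x - k%:~R <= 1 + 10^-1 ->
  spline x = piece (Z k) (Z (k + 1)) (Z (k + 2)) (x - k%:~R).
Proof.
move=> /andP[h1 h2]; rewrite /spline; set m := Num.floor x.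
have /andP[m1 m2] : m%:~R <= x < (m + 1)%:~R := floor_itv x.
rewrite intrD in m2.
have k1 : (m - 2)%:~R < (k%:~R : R) by rewrite intrD mulrNz; lra.
have k2 : (k%:~R : R) < (m + 2)%:~R by rewrite intrD; lra.
rewrite !ltr_int in k1 k2.
move: h1 h2; have [->|[->|->]] : k = m \/ k = m + 1 \/ k = m - 1.
  have [km|mk|->] := ltgtP k m; [right; right|right; left|by left]; apply/le_anti.
    by rewrite lerBrDr lezD1 km -lezD1 in k1 *; move: k1; rewrite (_ : m - 2 + 1 = m - 1) // ; ring.
  by rewrite lezD1 mk andbT -ltzD1 -addrA.
- by [].
- have E : ((m + 1)%:~R : R) = m%:~R + 1 by rewrite intrD.
  move=> h1' _; have -> : x - m%:~R = x - (m + 1)%:~R + 1 by rewrite E; ring.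
  have -> : m + 1 + 1 = m + 2 by ring.
  rewrite (piece_overlap _ _ _ (Z (m + 1 + 2))) //.
  by rewrite ler_norml; apply/andP; split; lra.
- have E : ((m - 1)%:~R : R) = m%:~R - 1 by rewrite intrD mulrNz.
  move=> _ h2'; have -> : x - (m - 1)%:~R = x - m%:~R + 1 by rewrite E; ring.
  have -> : m - 1 + 1 = m by ring.
  have -> : m - 1 + 2 = m + 1 by ring.
  rewrite (piece_overlap _ _ _ (Z (m + 2))) //.
  by rewrite ler_norml; apply/andP; split; lra.
Qed.

Lemma spline_near (x0 : R) : let k := Num.floor x0 in
  {near x0, spline =1 (fun x => piece (Z k) (Z (k + 1)) (Z (k + 2)) (x - k%:~R))}.
Proof.
move=> k; near=> x; apply: splineE.
have /andP[m1 m2] : k%:~R <= x0 < (k + 1)%:~R := floor_itv x0.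
rewrite intrD in m2.
have : `|x0 - x| < 10^-1.
  by near: x; apply/nbhs_normP; exists 10^-1 => //=; rewrite invr_gt0.
rewrite ltr_norml => /andP[h1 h2]; apply/andP; split; lra.
Unshelve. all: by end_near. Qed.

Lemma sm_spline : sm spline.
Proof.
apply: sm_local => x0; eexists; last exact: spline_near.
by apply: (sm_comp (sm_piece _ _ _)); apply: smB; [exact: sm_id|exact: sm_cst].
Qed.

Lemma is_derive_spline (x : R) : let k := Num.floor x in
  let t := ramp (x - k%:~R) in
  is_derive x 1 spline ((1 - t) * (Z (k + 1) - Z k) + t * (Z (k + 2) - Z (k + 1))).
Proof.
move=> k t.
have d1 : is_derive x 1 (fun x : R => x - k%:~R) 1.
  by have := is_deriveB (is_derive_id x 1) (is_derive_cst (k%:~R : R) x 1); rewrite subr0.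
have d2 := is_derive_compf (g := fun x : R => x - k%:~R) (is_derive_piece (Z k) (Z (k + 1)) (Z (k + 2)) (x - k%:~R)) d1.
rewrite mulr1 in d2; apply: near_eq_is_derive d2.
by have := spline_near x; apply: filterS => y ->.
Qed.

Lemma spline_periodic (N : int) : (forall k, Z (k + N) = Z k) ->
  forall x, spline (x + N%:~R) = spline x.
Proof.
move=> pZ x; rewrite /spline floorDrz ?intrKfloor //.
rewrite (addrAC _ N 1) (addrAC _ N 2) !pZ intrD; congr piece; ring.
Qed.

End Pieces.

Lemma derive_periodic (f : R -> R) : sm f -> (forall s, f (s + 1) = f s) ->
  forall s, 'D_1 f (s + 1) = 'D_1 f s.
Proof.
move=> sf pf s.
have d1 : is_derive s 1 (fun x : R => x + 1) 1.
  by have := is_deriveD (is_derive_id s 1) (is_derive_cst (1 : R) s 1); rewrite addr0.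
have := is_derive_compf (g := fun x : R => x + 1) (sm_is_derive (s + 1) 1 sf) d1.
rewrite mulr1 (_ : (fun y => f (y + 1)) = f); last exact/funext.
by case.
Qed.

Lemma periodic_bound (f : R -> R) : continuous f -> (forall s, f (s + 1) = f s) ->
  exists2 M, 0 <= M & forall s, `|f s| <= M.
Proof.
move=> fc pf; have [M M0 hM] := compact_bound 0 1 fc.
exists M => // s; have [m /andP[m1 m2]] := frac_itv s 0.
rewrite -(periodic_int pf m); apply: hM; lra.
Qed.

Definition scaled_spline (T : R -> R) (N : nat) (Z : int -> R) (s : R) := spline T Z (N%:R * s).

Lemma is_derive_scaled_spline (T : R -> R) (N : nat) (Z : int -> R) (s : R) :
  (forall t : R, is_derive t 1 T (ramp t)) ->
  (forall t, t <= 10^-1 -> T t = 0) -> (forall t, 9 / 10 <= t -> T t = t - 2^-1) ->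
  is_derive s 1 (scaled_spline T N Z)
   (N%:R * let k := Num.floor (N%:R * s) in let t := ramp (N%:R * s - k%:~R) in
    ((1 - t) * (Z (k + 1) - Z k) + t * (Z (k + 2) - Z (k + 1)))).
Proof.
move=> dT T0 T1.
have d1 : is_derive s 1 (fun s : R => N%:R * s) N%:R.
  have := is_deriveMf (is_derive_cst (N%:R : R) s 1) (is_derive_id s 1).
  by rewrite mul0r add0r mulr1.
have := is_derive_compf (g := fun s : R => N%:R * s) (is_derive_spline dT T0 T1 Z (N%:R * s)) d1.
by rewrite mulrC.
Qed.

(* The slopes of the spline are averages of difference quotients of its nodes. *)
Lemma spline_close (T : R -> R) (g : R -> R) (M1 M2 e : R) :
  sm T -> (forall t : R, is_derive t 1 T (ramp t)) ->
  (forall t, t <= 10^-1 -> T t = 0) -> (forall t, 9 / 10 <= t -> T t = t - 2^-1) ->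
  sm g -> (forall s, `|'D_1 g s| <= M1) -> (forall s, `|'D_1 ('D_1 g) s| <= M2) -> 
  forall (N : nat) (Z : int -> R), (0 < N)%N -> (forall k, `|Z k - g (k%:~R / N%:R)| <= e / N%:R) ->
  forall s, `|scaled_spline T N Z s - g s| <= (e + M1 + 2 * M2) / N%:R + 2 * e /\
   `|'D_1 (scaled_spline T N Z) s - 'D_1 g s| <= 2 * M2 / N%:R + 2 * e.
Proof.
move=> sT dT T0 T1 sg b1 b2 N Z N0 hZ.
have Np : 0 < (N%:R : R) by rewrite ltr0n.
have N1 : 1 <= (N%:R : R) by rewrite ler1n.
have Nn : (N%:R : R) != 0 by rewrite gt_eqF.
have dg (s : R) := sm_is_derive s 1 sg.
have dg2 (s : R) := sm_is_derive s 1 (sm_derive (1 : R) sg).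
have M10 : 0 <= M1 by apply: le_trans (b1 0).
have M20 : 0 <= M2 by apply: le_trans (b2 0).
have e0 : 0 <= e.
  by have := le_trans (normr_ge0 _) (hZ 0); rewrite ler_pdivlMr // mul0r.
have dS (s : R) := is_derive_scaled_spline N Z s dT T0 T1.
have quot (k : int) (s : R) : k%:~R / N%:R - N%:R^-1 <= s <= k%:~R / N%:R + 2 / N%:R ->
    `|N%:R * (Z (k + 1) - Z k) - 'D_1 g s| <= 2 * M2 / N%:R + 2 * e.
  move=> hs.
  have kk : k%:~R / N%:R <= (k + 1)%:~R / N%:R :> R.
    by rewrite ler_pM2r ?invr_gt0 // intrD lerDl.
  have [c hc Ec] := MVT_le kk (fun z _ => dg z).
  have lenk : (k + 1)%:~R / N%:R - k%:~R / N%:R = N%:R^-1 :> R by rewrite intrD; field.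
  have cs : `|c - s| <= 2 / N%:R.
    rewrite ler_norml; apply/andP; move: hc hs lenk; lra.
  have := derive_bound c s dg2 b2 => h1.
  have h2 := ler_wpM2l M20 cs.
  have hk1 := hZ (k + 1); have hk0 := hZ k.
  set a := Z (k + 1) in hk1 *; set b := Z k in hk0 *.
  set ga := g _ in hk1 Ec; set gb := g _ in hk0 Ec.
  have h3 : `|N%:R * (a - ga) - N%:R * (b - gb)| <= 2 * e.
    rewrite -mulrBr normrM (gtr0_norm Np) mulrC -ler_pdivlMr //.
    by apply: le_trans (ler_normB _ _) _; lra.
  have -> : N%:R * (a - b) - 'D_1 g s = N%:R * (a - ga) - N%:R * (b - gb) + ('D_1 g c - 'D_1 g s).
    have : N%:R * (ga - gb) = 'D_1 g c by rewrite Ec lenk mulrC mulfVK.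
    lra.
  apply: le_trans (ler_normD _ _) _; lra.
have D2 (s : R) : `|'D_1 (scaled_spline T N Z) s - 'D_1 g s| <= 2 * M2 / N%:R + 2 * e.
  have -> := derive_val (is_derive := dS s).
  move=> /=; set k := Num.floor _; set t := ramp _.
  have /andP[m1 m2] : k%:~R <= N%:R * s < (k + 1)%:~R := floor_itv _.
  rewrite intrD mulrC in m1 m2.
  have l1 : k%:~R / N%:R <= s by rewrite ler_pdivrMr.
  have l2 : s <= k%:~R / N%:R + N%:R^-1.
    by rewrite -[X in _ + X]mul1r -mulrDl ler_pdivlMr // ltW.
  have i0 : 0 < N%:R^-1 :> R by rewrite invr_gt0.
  have q1 := quot k s ltac:(lra).
  have E1 : (k + 1)%:~R / N%:R = k%:~R / N%:R + N%:R^-1 :> R by rewrite intrD; field.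
  have q2 := quot (k + 1) s ltac:(rewrite E1; lra).
  rewrite -addrA -[1 + 1]/(2 : int) in q2.
  have /andP[t0 t1] : 0 <= t <= 1 := ramp_itv _.
  have t1' : 0 <= 1 - t by lra.
  have := ler_wpM2l t1' q1; have := ler_wpM2l t0 q2.
  rewrite -{1}(ger0_norm t0) -{1}(ger0_norm t1') -!normrM => r1 r2.
  set B := _ + 2 * e in r1 r2 *.
  set u := t * _ in r1; set v := (1 - t) * _ in r2.
  have -> : N%:R * ((1 - t) * (Z (k + 1) - Z k) + t * (Z (k + 2) - Z (k + 1))) - 'D_1 g s = u + v.
    by rewrite /u /v; ring.
  by apply: le_trans (ler_normD _ _) _; lra.
split=> //.
pose k := Num.floor (N%:R * s).
have /andP[m1 m2] : k%:~R <= N%:R * s < (k + 1)%:~R := floor_itv _.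
rewrite intrD mulrC in m1 m2.
pose s0 : R := k%:~R / N%:R.
have i0 : 0 < N%:R^-1 :> R by rewrite invr_gt0.
have l1 : s0 <= s by rewrite ler_pdivrMr.
have l2 : s <= s0 + N%:R^-1.
  by rewrite -[X in _ + X]mul1r -mulrDl ler_pdivlMr // ltW.
have E0 : scaled_spline T N Z s0 = (Z k + Z (k + 1)) / 2.
  rewrite /scaled_spline (_ : N%:R * s0 = k%:~R); last by rewrite /s0; field.
  rewrite /spline intrKfloor subrr /piece T0; last by rewrite invr_ge0.
  by rewrite !mulr0 !addr0.
have d2 (x : R) : is_derive x 1 (fun s => scaled_spline T N Z s - g s) ('D_1 (scaled_spline T N Z) x - 'D_1 g x).
  apply: is_deriveB => //; case: (dS x) => [? E]; exact: DeriveDef.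
have h1 := derive_bound s s0 d2 D2.
have E1 : (k + 1)%:~R / N%:R = s0 + N%:R^-1 :> R by rewrite /s0 intrD; field.
have h2 := derive_bound (s0 + N%:R^-1) s0 dg b1.
have hk1 := hZ (k + 1); have hk0 := hZ k.
rewrite E1 in hk1; rewrite -/s0 in hk0.
rewrite E0 in h1; rewrite addrAC subrr add0r (gtr0_norm i0) in h2.
have ss0 : `|s - s0| <= N%:R^-1 by rewrite ger0_norm; lra.
have iN : N%:R^-1 <= 1 :> R by rewrite invf_le1.
have B0 : 0 <= 2 * M2 / N%:R + 2 * e by rewrite addr_ge0 // mulr_ge0 // ?mulr_ge0.
have h3 : (2 * M2 / N%:R + 2 * e) * `|s - s0| <= 2 * M2 / N%:R + 2 * e.
  by rewrite -[leRHS]mulr1 ler_wpM2l //; lra.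
move: h1 h2 hk1 hk0 h3; rewrite !ler_norml.
set x := scaled_spline _ _ _ _; set a := Z (k + 1); set b := Z k; set ga := g (s0 + _); set gb := g s0.
lra.
Qed.


End Spline.

Section SplineApproximation.
Context {R : realType}.

Lemma spline_quadratic (T : R -> R) (N : nat) (s0 c : R) :
  (forall t : R, is_derive t 1 T (ramp t)) ->
  (forall t, t <= 10^-1 -> T t = 0) -> (forall t, 9 / 10 <= t -> T t = t - 2^-1) ->
  (forall t, 5^-1 <= t <= 4 / 5 -> T t = t ^+ 2 / 2 + c) -> (0 < N)%N ->
  let k := Num.floor (N%:R * s0) in
  5^-1 < N%:R * s0 - k%:~R < 4 / 5 ->
  exists2 r, 0 < r & forall (Z : int -> R) s, `|s - s0| < r ->
    scaled_spline T N Z s = scaled_spline T N Z s0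
      + N%:R * (Z (k + 1) - Z k + (Z (k + 2) - 2 * Z (k + 1) + Z k) * (N%:R * s0 - k%:~R)) * (s - s0)
      + N%:R ^+ 2 * (Z (k + 2) - 2 * Z (k + 1) + Z k) / 2 * (s - s0) ^+ 2.
Proof.
move=> dT T0 T1 Tc N0 k /andP[h1 h2]; set t0 := _ - _ in h1 h2 *.
have Np : 0 < (N%:R : R) by rewrite ltr0n.
exists (Num.min (t0 - 5^-1) (4 / 5 - t0) / N%:R).
  by rewrite divr_gt0 // lt_min !subr_gt0 h1.
move=> Z s; rewrite ltr_pdivlMr // lt_min -{1 2}(gtr0_norm Np) -normrM mulrBl => /andP[].
rewrite !ltr_norml => /andP[a1 a2] /andP[b1 b2].
have E u : 5^-1 <= N%:R * u - k%:~R <= 4 / 5 -> scaled_spline T N Z u =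
    piece T (Z k) (Z (k + 1)) (Z (k + 2)) (N%:R * u - k%:~R).
  by move=> hu; apply: splineE => //; lra.
rewrite !E -/t0; [|lra|rewrite /t0 in h1 h2 a1 a2 b1 b2; lra].
rewrite /piece !Tc; [|lra|rewrite /t0 in h1 h2 a1 a2 b1 b2; lra].
by rewrite /t0; field.
Qed.

Lemma second_difference (g : R -> R) (M x h : R) : sm g ->
  (forall s, `|'D_1 ('D_1 g) s| <= M) -> 0 <= h ->
  `|g (x + h + h) - 2 * g (x + h) + g x| <= M * h ^+ 2.
Proof.
move=> sg b2 h0.
have dg2 (s : R) := sm_is_derive s 1 (sm_derive (1 : R) sg).
have xh : x <= x + h by rewrite lerDl.
have d1 (u : R) : is_derive u 1 (fun u : R => u + h) 1.
  by have := is_deriveD (is_derive_id u 1) (is_derive_cst (h : R) u 1); rewrite addr0.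
have dphi (u : R) : x <= u <= x + h -> is_derive u 1 (fun u => g (u + h) - g u) ('D_1 g (u + h) - 'D_1 g u).
  move=> _; apply: is_deriveB; last exact: sm_is_derive.
  by have := is_derive_compf (g := fun u : R => u + h) (sm_is_derive (u + h) 1 sg) (d1 u); rewrite mulr1.
have [c _ E] := MVT_le xh dphi.
have -> : g (x + h + h) - 2 * g (x + h) + g x = g (x + h + h) - g (x + h) - (g (x + h) - g x) by ring.
rewrite E (addrAC x) subrr add0r normrM (ger0_norm h0) expr2 mulrA ler_wpM2r //.
have := derive_bound (c + h) c dg2 b2.
by rewrite addrAC subrr add0r (ger0_norm h0).
Qed.

(* With node k rounded to the parity of k (in units of ep / N), all slopes of the
   z-spline are nonzero odd multiples of the unit, and consecutive slopes differ
   by less than 9/2 units. Hence the velocity can vanish only where ramp lies in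
   [2/9, 7/9], that is, where the spline is exactly quadratic. *)
Definition parity_round (k : int) (x : R) : int :=
  k + 2 * Num.floor ((x - k%:~R) / 2 + 2^-1).

Lemma parity_roundP k x : `|(parity_round k x)%:~R - x| <= 1.
Proof.
rewrite /parity_round intrD intrM; set f := Num.floor _.
have /andP[m1 m2] : f%:~R <= (x - k%:~R) / 2 + 2^-1 < (f + 1)%:~R := floor_itv _.
by rewrite intrD in m2; rewrite ler_norml; apply/andP; split; lra.
Qed.

Lemma parity_round_shift k (M : nat) x : parity_round (k + (2 * M)%N%:Z) x = parity_round k x.
Proof.
rewrite /parity_round.
have -> : (x - (k + (2 * M)%N%:Z)%:~R) / 2 + 2^-1 = (x - k%:~R) / 2 + 2^-1 + (- M%:Z)%:~R.
  by rewrite !intrD mulrNz -!pmulrn natrM; field.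
rewrite floorDrz ?intrKfloor; last by rewrite intr_int.
by rewrite PoszM; ring.
Qed.

Lemma parity_round_slope k x y : 
  1 <= `|((parity_round (k + 1) y)%:~R - (parity_round k x)%:~R : R)|.
Proof.
rewrite /parity_round; set f := Num.floor _; set f' := Num.floor _.
have -> : ((k + 1 + 2 * f)%:~R - (k + 2 * f')%:~R : R) = 1 + 2 * (f - f')%:~R.
  by rewrite !intrD !intrM mulrNz; ring.
rewrite ler_normr; have [h|h] := lerP 0 (f - f').
  have : 0 <= (f - f')%:~R :> R by rewrite ler0z.
  by move=> h'; apply/orP; left; lra.
have : (f - f' + 1)%:~R <= 0 :> R by rewrite lerz0 lezD1.
by rewrite intrD => h'; apply/orP; right; lra.
Qed.

Definition folds_quadratically (C : R -> 'rV[R]_3) := forall s0,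
  'D_1 (fun s => C s 0 ax2) s0 = 0 -> exists r kap b0 c0 b1 c1, [/\ 0 < r, kap != 0 &
   forall s, `|s - s0| < r -> [/\ C s 0 ax2 = C s0 0 ax2 + kap * (s - s0) ^+ 2,
     C s 0 ax0 = C s0 0 ax0 + b0 * (s - s0) + c0 * (s - s0) ^+ 2 &
     C s 0 ax1 = C s0 0 ax1 + b1 * (s - s0) + c1 * (s - s0) ^+ 2]].

Theorem spline_approximation (g : R -> 'rV[R]_3) (e : R) : sm g ->
  (forall s, g (s + 1) = g s) -> 0 < e -> exists C : R -> 'rV[R]_3, 
  [/\ sm C, forall s, C (s + 1) = C s, 
     forall s j, `|C s 0 j - g s 0 j| <= e,
     forall s j, `|'D_1 (fun s => C s 0 j) s - 'D_1 (fun s => g s 0 j) s| <= e &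
     folds_quadratically C].
Proof.
move=> sg pg e0.
have sgj j : sm (fun s => g s 0 j) := sm_comp (sm_coord j) sg.
have pgj j s : g (s + 1) 0 j = g s 0 j by rewrite pg.
have [M [M0 b1 b2]] : exists M, [/\ 0 <= M, forall j s, `|'D_1 (fun s => g s 0 j) s| <= M &
     forall j s, `|'D_1 ('D_1 (fun s => g s 0 j)) s| <= M].
  have H j : exists M, [/\ 0 <= M, forall s, `|'D_1 (fun s => g s 0 j) s| <= M &
     forall s, `|'D_1 ('D_1 (fun s => g s 0 j)) s| <= M].
    have s1 := sm_derive (1 : R) (sgj j); have p1 := derive_periodic (sgj j) (pgj j).
    have s2 := sm_derive (1 : R) s1; have p2 := derive_periodic s1 p1.
    have [M M0 hM] := periodic_bound (sm_continuous s1) p1.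
    have [M' M'0 hM'] := periodic_bound (sm_continuous s2) p2.
    exists (M + M'); split; first exact: addr_ge0.
      by move=> s; apply: le_trans (hM s) _; rewrite lerDl.
    by move=> s; apply: le_trans (hM' s) _; rewrite lerDr.
  have [M hM] := choice H.
  have Mj j : M j <= \sum_j M j.
    by rewrite (bigD1 j) //= lerDl sumr_ge0 // => i _; have [] := hM i.
  exists (\sum_j M j); split.
  - by apply: sumr_ge0 => i _; have [] := hM i.
  - by move=> j s; have [_ h _] := hM j; apply: le_trans (h s) (Mj j).
  - by move=> j s; have [_ _ h] := hM j; apply: le_trans (h s) (Mj j).
have [T [sT dT T0 T1 [c Tc]]] := @ramp_primitive R.
pose ep := e / 8; have ep0 : 0 < ep by rewrite divr_gt0.
pose q := (ep + 4 * M) / ep.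
have q0 : 0 <= q by apply: divr_ge0; lra.
pose N := (2 * (Num.bound q).+1)%N.
have N0 : (0 < N)%N by rewrite /N.
have Np : 0 < (N%:R : R) by rewrite ltr0n.
have qN : q <= N%:R.
  apply: ltW; apply: lt_le_trans (archi_boundP q0) _; by rewrite ler_nat /N mul2n -addnn addSn ltnW // ltnS leq_addr.
have qN2 : ep + 4 * M <= N%:R * ep by rewrite -ler_pdivrMr.
pose Z (j : 'I_3) (k : int) : R := if j == ax2 then ep / N%:R * (parity_round k (N%:R * g (k%:~R / N%:R) 0 ax2 / ep))%:~R
   else g (k%:~R / N%:R) 0 j.
have per (k : int) : g ((k + N%:Z)%:~R / N%:R) = g (k%:~R / N%:R).
  by rewrite intrD mulrDl -pmulrn mulfV ?gt_eqF.
have ZN j (k : int) : Z j (k + N%:Z) = Z j k.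
  rewrite /Z; case: ifP => _; last by rewrite per.
  by rewrite per parity_round_shift.
have Zg j k : `|Z j k - g (k%:~R / N%:R) 0 j| <= ep / N%:R.
  have epN : 0 < ep / N%:R by rewrite divr_gt0.
  rewrite /Z; case: eqP => [->|_]; last by rewrite subrr normr0 ltW.
  set x := N%:R * _ / ep; have hx := parity_roundP k x.
  have -> : g (k%:~R / N%:R) 0 ax2 = ep / N%:R * x by rewrite /x; field; rewrite !gt_eqF.
  by rewrite -mulrBr normrM (gtr0_norm epN) ler_piMr // ltW.
pose C s : 'rV[R]_3 := \row_j scaled_spline T N (Z j) s.
have CE j : (fun s => C s 0 j) = scaled_spline T N (Z j).
  by apply/funext => s; rewrite mxE.
have bnd : (ep + M + 2 * M) / N%:R <= 6 * ep.
  by rewrite ler_pdivrMr //; nra.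
have close j s := spline_close sT dT T0 T1 (sgj j) (b1 j) (b2 j) N0 (Zg j) s.
exists C; split.
- apply: sm_row => j; rewrite CE; apply: (sm_comp (sm_spline sT T0 T1 _)).
  by apply: smM; [exact: sm_cst|exact: sm_id].
- move=> s; apply/rowP => j; rewrite !mxE /scaled_spline mulrDr mulr1 pmulrn.
  exact: spline_periodic (ZN j) _.
- move=> s j; have [h _] := close j s.
  rewrite mxE; apply: le_trans h _; rewrite /ep in bnd *; lra.
- move=> s j; have [_ h] := close j s.
  have i1 : 0 <= N%:R^-1 :> R by rewrite invr_ge0 ltW.
  have := mulr_ge0 (ltW ep0) i1; have := mulr_ge0 M0 i1.
  rewrite CE => g1 g2; apply: le_trans h _; rewrite /ep in bnd g2 *; lra.
move=> s0; rewrite CE => D0.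
move: (D0); rewrite (derive_val (is_derive := is_derive_scaled_spline N (Z ax2) s0 dT T0 T1)) /=.
set k := Num.floor _; set t0 := N%:R * s0 - k%:~R; set th := ramp t0.
pose a (k : int) : R := (parity_round k (N%:R * g (k%:~R / N%:R) 0 ax2 / ep))%:~R.
have ZE i : Z ax2 i = ep / N%:R * a i by [].
have epN : 0 < ep / N%:R by rewrite divr_gt0.
pose m0 := a (k + 1) - a k; pose m1 := a (k + 2) - a (k + 1).
have m01 : 1 <= `|m0| by exact: parity_round_slope.
have m11 : 1 <= `|m1|.
  by rewrite /m1 (_ : k + 2 = k + 1 + 1); [exact: parity_round_slope|ring].
have -> : N%:R * ((1 - th) * (Z ax2 (k + 1) - Z ax2 k) + th * (Z ax2 (k + 2) - Z ax2 (k + 1)))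
   = ep * ((1 - th) * m0 + th * m1).
  by rewrite !ZE /m0 /m1; field; rewrite gt_eqF.
move=> /eqP; rewrite mulf_eq0 (gt_eqF ep0) /= => /eqP th0.
pose D2 j := Z j (k + 2) - 2 * Z j (k + 1) + Z j k.
have D2m : D2 ax2 = ep / N%:R * (m1 - m0) by rewrite /D2 !ZE /m0 /m1; ring.
have mm : `|m1 - m0| <= 9 / 2.
  have Ni : 0 <= N%:R^-1 :> R by rewrite invr_ge0 ltW.
  have := second_difference (k%:~R / N%:R) (sgj ax2) (b2 ax2) Ni.
  have E1 : k%:~R / N%:R + N%:R^-1 = (k + 1)%:~R / N%:R :> R by rewrite intrD; field; rewrite gt_eqF.
  have E2 : (k + 1)%:~R / N%:R + N%:R^-1 = (k + 2)%:~R / N%:R :> R by rewrite !intrD; field; rewrite gt_eqF.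
  rewrite E1 E2 => sd.
  have z0 := Zg ax2 k; have z1 := Zg ax2 (k + 1); have z2 := Zg ax2 (k + 2).
  have D2b : `|D2 ax2| <= M * N%:R^-1 ^+ 2 + 4 * (ep / N%:R).
    rewrite /D2; move: sd z0 z1 z2; rewrite !ler_norml.
    set g0 := g _ 0 ax2; set g1 := g _ 0 ax2; set g2 := g _ 0 ax2; lra.
  move: D2b; rewrite D2m normrM (gtr0_norm epN) mulrC -ler_pdivlMr // => /le_trans; apply.
  rewrite ler_pdivrMr //.
  have -> : M * N%:R^-1 ^+ 2 = M / N%:R / N%:R by rewrite expr2; ring.
  have -> : 9 / 2 * (ep / N%:R) = 4 * (ep / N%:R) + (ep / 2) / N%:R by field; rewrite gt_eqF.
  by rewrite addrC lerD2l ler_wpM2r // ler_pdivrMr //; lra.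
have /andP[th1 th2] : 0 <= th <= 1 := ramp_itv _.
have thm : 5^-1 < t0 < 4 / 5.
  apply: ramp_mid_inv; rewrite -/th.
  have e0' : m0 = - th * (m1 - m0) by move: th0; lra.
  have e1' : m1 = (1 - th) * (m1 - m0) by move: th0; lra.
  have th3 : 0 <= 1 - th by lra.
  have f0 := ler_wpM2l th1 mm; have f1 := ler_wpM2l th3 mm.
  rewrite e0' normrM normrN (ger0_norm th1) in m01.
  rewrite e1' normrM (ger0_norm th3) in m11.
  by apply/andP; split; lra.
have [r r0 hr] := spline_quadratic dT T0 T1 Tc N0 thm.
have tham : th = t0 by apply: ramp_mid; lra.
pose S j := N%:R * (Z j (k + 1) - Z j k + D2 j * t0).
pose Q j := N%:R ^+ 2 * D2 j / 2.
exists r, (Q ax2), (S ax0), (Q ax0), (S ax1), (Q ax1); split=> //.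
  have mm0 : m1 - m0 != 0.
    apply/eqP => mm0; have m10 : m1 = m0 by lra.
    have m00 : m0 = 0 by move: th0; rewrite m10; lra.
    by move: m01; rewrite m00 normr0; lra.
  have Nn : (N%:R : R) != 0 by rewrite gt_eqF.
  have epn : ep / N%:R != 0 by rewrite gt_eqF.
  have hn : 2^-1 != 0 :> R by rewrite invr_neq0.
  by rewrite /Q D2m (mulf_neq0 (mulf_neq0 (expf_neq0 2 Nn) (mulf_neq0 epn mm0)) hn).
move=> s sr; split; rewrite !mxE; rewrite (hr _ s sr) //.
rewrite -/(D2 ax2) -/t0 -tham -/(Q ax2).
suff -> : Z ax2 (k + 1) - Z ax2 k + D2 ax2 * th = 0 by rewrite mulr0 mul0r addr0.
rewrite D2m !ZE.
have -> : ep / N%:R * a (k + 1) - ep / N%:R * a k + ep / N%:R * (m1 - m0) * th = ep / N%:R * ((1 - th) * m0 + th * m1).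
  by rewrite /m0; ring.
by rewrite th0 mulr0.
Qed.

End SplineApproximation.

From mathcomp Require Import complex.

Section ComplexCalculus.
Context {R : realType}.
Local Notation C := R[i].
Implicit Types V : normedModType R.

Lemma complex_eqP (a b : C) : complex.Re a = complex.Re b -> complex.Im a = complex.Im b -> a = b.
Proof. by case: a b => [? ?] [? ?] /= -> ->. Qed.
Lemma Re_addc (a b : C) : complex.Re (a + b) = complex.Re a + complex.Re b.
Proof. by case: a b => [? ?] []. Qed.
Lemma Im_addc (a b : C) : complex.Im (a + b) = complex.Im a + complex.Im b.
Proof. by case: a b => [? ?] []. Qed.
Lemma Re_oppc (a : C) : complex.Re (- a) = - complex.Re a. Proof. by case: a. Qed.
Lemma Im_oppc (a : C) : complex.Im (- a) = - complex.Im a. Proof. by case: a. Qed.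
Lemma Re_mulc (a b : C) : complex.Re (a * b) = complex.Re a * complex.Re b - complex.Im a * complex.Im b.
Proof. by case: a b => [? ?] []. Qed.
Lemma Im_mulc (a b : C) : complex.Im (a * b) = complex.Re a * complex.Im b + complex.Im a * complex.Re b.
Proof. by case: a b => [? ?] [? ?]; rewrite /= addrC. Qed.
Lemma Re_conjc (a : C) : complex.Re (conjc a) = complex.Re a. Proof. by case: a. Qed.
Lemma Im_conjc (a : C) : complex.Im (conjc a) = - complex.Im a. Proof. by case: a. Qed.

Definition csm V (f : V -> C) :=
  sm (fun x => complex.Re (f x)) /\ sm (fun x => complex.Im (f x)).

Lemma csm_cst V (c : C) : csm (fun _ : V => c).
Proof. by split; exact: sm_cst. Qed.

Lemma csmD V (f g : V -> C) : csm f -> csm g -> csm (fun x => f x + g x).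
Proof.
move=> [f1 f2] [g1 g2]; split.
  by under eq_fun do rewrite Re_addc; exact: smD.
by under eq_fun do rewrite Im_addc; exact: smD.
Qed.

Lemma csmN V (f : V -> C) : csm f -> csm (fun x => - f x).
Proof.
move=> [f1 f2]; split.
  by under eq_fun do rewrite Re_oppc; exact: smN.
by under eq_fun do rewrite Im_oppc; exact: smN.
Qed.

Lemma csmB V (f g : V -> C) : csm f -> csm g -> csm (fun x => f x - g x).
Proof. by move=> sf sg; apply: csmD => //; exact: csmN. Qed.

Lemma csmM V (f g : V -> C) : csm f -> csm g -> csm (fun x => f x * g x).
Proof.
move=> [f1 f2] [g1 g2]; split.
  by under eq_fun do rewrite Re_mulc; apply: smB; exact: smM.
by under eq_fun do rewrite Im_mulc; apply: smD; exact: smM.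
Qed.

Lemma csmJ V (f : V -> C) : csm f -> csm (fun x => conjc (f x)).
Proof.
move=> [f1 f2]; split.
  by under eq_fun do rewrite Re_conjc.
by under eq_fun do rewrite Im_conjc; exact: smN.
Qed.

Lemma csm_complex V (f g : V -> R) : sm f -> sm g -> csm (fun x => Complex (f x) (g x)).
Proof. by []. Qed.

Lemma csm_comp V V' (f : V -> C) (g : V' -> V) : csm f -> sm g -> csm (fun x => f (g x)).
Proof. by move=> [f1 f2] sg; split; [exact: (sm_comp f1)|exact: (sm_comp f2)]. Qed.

Definition cder V (f : V -> C) (x v : V) (D : C) :=
  is_derive x v (fun y => complex.Re (f y)) (complex.Re D) /\
  is_derive x v (fun y => complex.Im (f y)) (complex.Im D).

Lemma cder_cst V (c : C) (x v : V) : cder (fun=> c) x v 0.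
Proof. by split; exact: is_derive_cst. Qed.

Lemma cderD V (f g : V -> C) x v a b : cder f x v a -> cder g x v b ->
  cder (fun y => f y + g y) x v (a + b).
Proof.
move=> [f1 f2] [g1 g2]; split.
  by under eq_fun do rewrite Re_addc; rewrite Re_addc; exact: is_deriveD.
by under eq_fun do rewrite Im_addc; rewrite Im_addc; exact: is_deriveD.
Qed.

Lemma cderM V (f g : V -> C) x v a b : cder f x v a -> cder g x v b ->
  cder (fun y => f y * g y) x v (a * g x + f x * b).
Proof.
move=> [f1 f2] [g1 g2]; split.
  under eq_fun do rewrite Re_mulc.
  apply: (is_derive_eq (is_deriveB (is_deriveM f1 g1) (is_deriveM f2 g2))).
  by rewrite Re_addc !Re_mulc /GRing.scale /=; ring.
under eq_fun do rewrite Im_mulc.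
apply: (is_derive_eq (is_deriveD (is_deriveM f1 g2) (is_deriveM f2 g1))).
by rewrite Im_addc !Im_mulc /GRing.scale /=; ring.
Qed.

Lemma cderN V (f : V -> C) x v a : cder f x v a -> cder (fun y => - f y) x v (- a).
Proof.
move=> [f1 f2]; split.
  by under eq_fun do rewrite Re_oppc; rewrite Re_oppc; exact: is_deriveN.
by under eq_fun do rewrite Im_oppc; rewrite Im_oppc; exact: is_deriveN.
Qed.

Lemma cderJ V (f : V -> C) x v a : cder f x v a ->
  cder (fun y => conjc (f y)) x v (conjc a).
Proof.
move=> [f1 f2]; split.
  by under eq_fun do rewrite Re_conjc; rewrite Re_conjc.
by under eq_fun do rewrite Im_conjc; rewrite Im_conjc; exact: is_deriveN.
Qed.

Definition wc (x : 'rV[R]_3) : C := Complex (x 0 ax0) (x 0 ax1).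
Definition wbar (x : 'rV[R]_3) : C := conjc (wc x).
Definition zc (x : 'rV[R]_3) : R := x 0 ax2.

Lemma is_derive_coord (x v : 'rV[R]_3) j :
  is_derive x v (fun y : 'rV[R]_3 => y 0 j) (v 0 j).
Proof.
have h : derivable (fun y : 'rV[R]_3 => y) x v by exact: derivable_id.
split; first by apply/diff_derivable; exact: differentiable_coord.
have := derive_mx h; rewrite derive_id => /rowP/(_ j).
by rewrite mxE => <-.
Qed.

Lemma cder_wbar x v : cder wbar x v (wbar v).
Proof. by apply: cderJ; split; exact: is_derive_coord. Qed.

Definition cd (a : R -> C) (u : R) : C :=
  Complex ('D_1 (fun s => complex.Re (a s)) u) ('D_1 (fun s => complex.Im (a s)) u).

Lemma csm_cd (a : R -> C) : csm a -> csm (cd a).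
Proof. by move=> [a1 a2]; apply: csm_complex; exact: sm_derive. Qed.

Lemma is_derive_zcomp (f : R -> R) (x v : 'rV[R]_3) : sm f ->
  is_derive x v (fun y => f (zc y)) ('D_1 f (zc x) * zc v).
Proof.
move=> sf.
have szc : sm zc by exact: sm_coord.
have df := sm_differentiable (zc x) sf; have dz := sm_differentiable x szc.
split; first by apply/diff_derivable; apply: (differentiable_comp dz df).
rewrite deriveE; last exact: (differentiable_comp dz df).
rewrite (diff_comp dz df) /= -(deriveE _ dz) (derive_val (is_derive := is_derive_coord x v ax2)).
by rewrite diff1E // derive1E mulrC.
Qed.

Lemma cder_zcomp (a : R -> C) x v : csm a ->
  cder (fun y => a (zc y)) x v (cd a (zc x) * (zc v)%:C%C).
Proof.
move=> [a1 a2]; split.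
  by rewrite Re_mulc /= mulr0 subr0; exact: is_derive_zcomp.
by rewrite Im_mulc /= mulr0 add0r; exact: is_derive_zcomp.
Qed.

Lemma cd_primitive (a : R -> C) : csm a -> exists A : R -> C, csm A /\ cd A = a.
Proof.
move=> [a1 a2].
have [A1 sA1 dA1] := sm_primitive a1; have [A2 sA2 dA2] := sm_primitive a2.
exists (fun u => Complex (A1 u) (A2 u)); split=> //.
apply/funext => u; apply: complex_eqP => /=; exact: derive_val.
Qed.

(* Polynomials in the variable eta (to be conj w) whose coefficients are smooth
   functions of u (to be z), in Horner form. *)
Inductive pol : (C -> R -> C) -> Prop :=
| pol0 : pol (fun _ _ => 0)
| polS a p : csm a -> pol p -> pol (fun eta u => a u + eta * p eta u).

Lemma pol_eq p q : (forall eta u, p eta u = q eta u) -> pol p -> pol q.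
Proof. by move=> pq; have -> : q = p by apply/funext => eta; apply/funext => u. Qed.

Lemma polC (a : R -> C) : csm a -> pol (fun _ u => a u).
Proof.
move=> sa; apply: pol_eq (polS sa pol0) => eta u /=.
by rewrite mulr0 addr0.
Qed.

Lemma polX : pol (fun eta _ => eta).
Proof.
apply: pol_eq (polS (@csm_cst R 0) (polC (@csm_cst R 1))) => eta u /=.
by rewrite mulr1 add0r.
Qed.

Lemma polD p q : pol p -> pol q -> pol (fun eta u => p eta u + q eta u).
Proof.
move=> pp; elim: pp q => [|a p' sa pp IH] q pq.
  by apply: pol_eq pq => eta u; rewrite add0r.
case: pq => [|b q' sb pq].
  by apply: pol_eq (polS sa pp) => eta u; rewrite addr0.
apply: pol_eq (polS (csmD sa sb) (IH _ pq)) => eta u /=.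
by rewrite mulrDr addrACA.
Qed.

Lemma polZ a p : csm a -> pol p -> pol (fun eta u => a u * p eta u).
Proof.
move=> sa; elim=> [|b p' sb pp IH].
  by apply: pol_eq pol0 => eta u; rewrite mulr0.
apply: pol_eq (polS (csmM sa sb) IH) => eta u /=.
by rewrite mulrDr; congr (_ + _); rewrite mulrCA.
Qed.

Lemma polM p q : pol p -> pol q -> pol (fun eta u => p eta u * q eta u).
Proof.
move=> pp; elim: pp q => [|a p' sa pp IH] q pq.
  by apply: pol_eq pol0 => eta u; rewrite mul0r.
apply: pol_eq (polD (polZ sa pq) (polS (@csm_cst R 0) (IH _ pq))) => eta u /=.
by rewrite add0r mulrDl mulrA.
Qed.

Lemma polB p q : pol p -> pol q -> pol (fun eta u => p eta u - q eta u).
Proof.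
move=> pp pq; apply: pol_eq (polD pp (polZ (@csm_cst R (-1)) pq)) => eta u /=.
by rewrite mulN1r.
Qed.

Lemma polXn k : pol (fun eta _ => eta ^+ k).
Proof.
elim: k => [|k IH]; first exact: (polC (@csm_cst R 1)).
by apply: pol_eq (polM polX IH) => eta u; rewrite exprS.
Qed.

Lemma csm_pol p : pol p -> csm (fun x => p (wbar x) (zc x)).
Proof.
have sz : sm zc by exact: sm_coord.
elim=> [|a q sa pq IH]; first exact: csm_cst.
apply: csmD; first exact: csm_comp.
apply: csmM => //; apply: csmJ; apply: csm_complex; exact: sm_coord.
Qed.

Definition pol_der (p pe pu : C -> R -> C) := forall x v,
  cder (fun y => p (wbar y) (zc y)) x v
    (pe (wbar x) (zc x) * wbar v + pu (wbar x) (zc x) * (zc v)%:C%C).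

Lemma pol_der_monomial a k : csm a -> pol_der (fun eta u => a u * eta ^+ k)
  (fun eta u => k%:R * a u * eta ^+ k.-1) (fun eta u => cd a u * eta ^+ k).
Proof.
move=> sa x v.
have dk : cder (fun y => wbar y ^+ k) x v (k%:R * wbar x ^+ k.-1 * wbar v).
  elim: k => [|k IH]; first by rewrite !mul0r; exact: cder_cst.
  have -> : (fun y => wbar y ^+ k.+1) = (fun y => wbar y * wbar y ^+ k).
    by apply/funext => y; rewrite exprS.
  have -> : k.+1%:R * wbar x ^+ k.+1.-1 * wbar v =
     wbar v * wbar x ^+ k + wbar x * (k%:R * wbar x ^+ k.-1 * wbar v).
    by case: k {IH} => [|k]; rewrite /= -?natr1 ?exprS ?expr0; ring.
  by apply: cderM => //; exact: cder_wbar.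
have := cderM (cder_zcomp x v sa) dk.
by congr cder; ring.
Qed.

(* The Maxwell equations for F = (F1, F2, F3) travelling along z reduce to these
   relations between F3 = f, F1 + i F2 = g and F1 - i F2 = h. *)
Definition wave_potentials (f g h : C -> R -> C) := exists fe fu ge hu,
  [/\ pol_der f fe fu, pol_der g ge fe & pol_der h (fun eta u => - fu eta u) hu].

Lemma wave_potentialsD f g h f' g' h' : wave_potentials f g h -> wave_potentials f' g' h' ->
  wave_potentials (fun eta u => f eta u + f' eta u) (fun eta u => g eta u + g' eta u)
    (fun eta u => h eta u + h' eta u).
Proof.
move=> [fe [fu [ge [hu [d1 d2 d3]]]]] [fe' [fu' [ge' [hu' [d1' d2' d3']]]]].
exists (fun eta u => fe eta u + fe' eta u), (fun eta u => fu eta u + fu' eta u),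
  (fun eta u => ge eta u + ge' eta u), (fun eta u => hu eta u + hu' eta u).
split=> x v.
- by have := cderD (d1 x v) (d1' x v); congr cder; ring.
- by have := cderD (d2 x v) (d2' x v); congr cder; ring.
- by have := cderD (d3 x v) (d3' x v); congr cder; ring.
Qed.

Lemma wave_potentials_exist f : pol f ->
  exists g h, [/\ pol g, pol h & wave_potentials f g h].
Proof.
move=> pf; suff : forall k, exists g h, [/\ pol g, pol h & wave_potentials (fun eta u => eta ^+ k * f eta u) g h].
  move=> /(_ 0%N) [g [h [pg ph [fe [fu [ge [hu [d1 d2 d3]]]]]]]].
  exists g, h; split=> //; exists fe, fu, ge, hu; split=> // x v.
  by have := d1 x v; congr cder; apply/funext => y; rewrite mul1r.
elim: pf => [|a p sa pp IH] k.
  exists (fun _ _ => 0), (fun _ _ => 0); split; try exact: pol0.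
  exists (fun _ _ => 0), (fun _ _ => 0), (fun _ _ => 0), (fun _ _ => 0).
  have d0 : pol_der (fun _ _ => 0) (fun _ _ => 0) (fun _ _ => 0).
    by move=> x v; rewrite !mul0r addr0; exact: cder_cst.
  split=> // x v.
    by have := d0 x v; congr cder; apply/funext => y; rewrite mulr0.
  by have := d0 x v; congr cder; rewrite oppr0.
have [g [h [pg ph wp]]] := IH k.+1.
have [A [sA dA]] := cd_primitive sa.
pose g1 (eta : C) u := k%:R * A u * eta ^+ k.-1.
pose h1 (eta : C) u := - k.+1%:R^-1 * cd a u * eta ^+ k.+1.
have sc (c : C) (b : R -> C) : csm b -> csm (fun u => c * b u).
  by move=> sb; apply: csmM => //; exact: csm_cst.
have pg1 : pol g1 by apply: polM; [apply: polC; exact: sc|exact: polXn].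
have ph1 : pol h1 by apply: polM; [apply: polC; apply: sc; exact: csm_cd|exact: polXn].
have cd_sc (c : C) (b : R -> C) u : csm b -> cd (fun u => c * b u) u = c * cd b u.
  move=> sb; have := cderM (@cder_cst R c u 1) (conj (sm_is_derive u 1 sb.1) (sm_is_derive u 1 sb.2) : cder b u 1 (cd b u)).
  by rewrite mul0r add0r => -[e1 e2]; apply: complex_eqP; exact: derive_val.
have wp1 : wave_potentials (fun eta u => a u * eta ^+ k) g1 h1.
  exists (fun eta u => k%:R * a u * eta ^+ k.-1), (fun eta u => cd a u * eta ^+ k),
    (fun eta u => k.-1%:R * (k%:R * A u) * eta ^+ k.-1.-1), (fun eta u => cd (fun u => - k.+1%:R^-1 * cd a u) u * eta ^+ k.+1).
  split; first exact: pol_der_monomial.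
    move=> x v; have := pol_der_monomial k.-1 (sc k%:R A sA) x v.
    by congr cder; rewrite cd_sc // dA.
  move=> x v; have := pol_der_monomial k.+1 (sc (- k.+1%:R^-1) _ (csm_cd sa)) x v.
  congr cder; congr (_ * _ + _) => /=.
  by field; rewrite nat1r pnatr_eq0.
exists (fun eta u => g1 eta u + g eta u), (fun eta u => h1 eta u + h eta u); split; try exact: polD.
have [fe [fu [ge [hu [d1 d2 d3]]]]] := wave_potentialsD wp1 wp.
exists fe, fu, ge, hu; split=> // x v.
by have := d1 x v; congr cder; apply/funext => y; rewrite exprS; ring.
Qed.

End ComplexCalculus.

Section MaxwellWaves.
Context {R : realType}.
Local Notation C := R[i].
Local Notation e3 := (evec ax2 : 'rV[R]_3).

Lemma derive_translate (V W : normedModType R) (f : V -> W) (c x v : V) :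
  'D_v (fun y => f (y - c)) x = 'D_v f (x - c).
Proof. by rewrite /derive /=; under eq_fun do rewrite -addrA. Qed.

Lemma derive_along (V W : normedModType R) (f : V -> W) (x v : V) (t : R) : sm f ->
  'D_1 (fun s : R => f (x - s *: v)) t = - 'D_v f (x - t *: v).
Proof.
move=> sf; pose l (s : R) := x - s *: v.
have sl : sm l.
  by apply: smB; [exact: sm_cst|apply: smZ; [exact: sm_id|exact: sm_cst]].
have dl := sm_differentiable t sl; have df := sm_differentiable (l t) sf.
have El : 'D_1 l t = - v.
  have sv : sm (fun s : R => s *: v) by apply: smZ; [exact: sm_id|exact: sm_cst].
  rewrite /l deriveB //; last exact: diff_derivable (sm_differentiable _ sv).
  rewrite derive_cst sub0r; congr (- _).
  rewrite deriveE; last exact: sm_differentiable.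
  have -> : (fun s : R => s *: v) = ( *:%R^~ v) by [].
  by rewrite diff_val scale1r.
rewrite deriveE; last exact: (differentiable_comp dl df).
by rewrite (diff_comp dl df) /= -(deriveE _ dl) El linearN -deriveE.
Qed.

Definition re_field (F : 'I_3 -> 'rV[R]_3 -> C) (t : R) (x : 'rV[R]_3) : 'rV[R]_3 :=
  \row_j complex.Re (F j (x - t *: e3)).
Definition im_field (F : 'I_3 -> 'rV[R]_3 -> C) (t : R) (x : 'rV[R]_3) : 'rV[R]_3 :=
  \row_j complex.Im (F j (x - t *: e3)).

Lemma derive_row (V : normedModType R) (f : V -> 'rV[R]_3) x v j : sm f ->
  'D_v f x 0 j = 'D_v (fun y => f y 0 j) x.
Proof.
move=> sf; rewrite derive_mx ?mxE //.
exact: diff_derivable (sm_differentiable _ sf).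
Qed.

Lemma maxwell_wave (F : 'I_3 -> 'rV[R]_3 -> C) (D : 'I_3 -> 'rV[R]_3 -> 'rV[R]_3 -> C) :
  (forall j, csm (F j)) -> (forall j x v, cder (F j) x v (D j x v)) ->
  (forall x, D ax0 x (evec ax0) + D ax1 x (evec ax1) + D ax2 x (evec ax2) = 0) ->
  (forall x, D ax2 x (evec ax1) - D ax1 x (evec ax2) = - ('i%C * D ax0 x (evec ax2))) ->
  (forall x, D ax0 x (evec ax2) - D ax2 x (evec ax0) = - ('i%C * D ax1 x (evec ax2))) ->
  (forall x, D ax1 x (evec ax0) - D ax0 x (evec ax1) = - ('i%C * D ax2 x (evec ax2))) ->
  maxwell (re_field F) (im_field F).
Proof.
move=> sF dF h0 h1 h2 h3.
have sre t : sm (re_field F t).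
  apply: sm_row => j; under eq_fun do rewrite mxE.
  by apply: (sm_comp (sF j).1); apply: smB; [exact: sm_id|exact: sm_cst].
have sim t : sm (im_field F t).
  apply: sm_row => j; under eq_fun do rewrite mxE.
  by apply: (sm_comp (sF j).2); apply: smB; [exact: sm_id|exact: sm_cst].
have stx : sm (fun p : R * 'rV[R]_3 => p.2 - p.1 *: e3).
  by apply: smB; [exact: sm_snd|apply: smZ; [exact: sm_fst|exact: sm_cst]].
have sret x : sm (fun t => re_field F t x).
  apply: sm_row => j; under eq_fun do rewrite mxE.
  apply: (sm_comp (sF j).1); apply: smB; first exact: sm_cst.
  by apply: smZ; [exact: sm_id|exact: sm_cst].
have simt x : sm (fun t => im_field F t x).
  apply: sm_row => j; under eq_fun do rewrite mxE.
  apply: (sm_comp (sF j).2); apply: smB; first exact: sm_cst.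
  by apply: smZ; [exact: sm_id|exact: sm_cst].
split; last split.
- apply: sm_smooth; apply: sm_row => j; under eq_fun do rewrite mxE.
  exact: (sm_comp (sF j).1 stx).
- apply: sm_smooth; apply: sm_row => j; under eq_fun do rewrite mxE.
  exact: (sm_comp (sF j).2 stx).
move=> t x; pose y := x - t *: e3.
have pdre i j : pd (re_field F t) i j x = complex.Re (D j y (evec i)).
  rewrite /pd derive_row //; under eq_fun do rewrite mxE.
  rewrite (derive_translate (fun y => complex.Re (F j y))).
  by have [d1 _] := dF j y (evec i); exact: derive_val.
have pdim i j : pd (im_field F t) i j x = complex.Im (D j y (evec i)).
  rewrite /pd derive_row //; under eq_fun do rewrite mxE.
  rewrite (derive_translate (fun y => complex.Im (F j y))).
  by have [_ d1] := dF j y (evec i); exact: derive_val.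
have dtre j : dt (re_field F) t x 0 j = - complex.Re (D j y e3).
  rewrite /dt derive_row //; under eq_fun do rewrite mxE.
  rewrite (derive_along _ _ _ (sF j).1); congr (- _).
  by have [d1 _] := dF j y e3; exact: derive_val.
have dtim j : dt (im_field F) t x 0 j = - complex.Im (D j y e3).
  rewrite /dt derive_row //; under eq_fun do rewrite mxE.
  rewrite (derive_along _ _ _ (sF j).2); congr (- _).
  by have [_ d1] := dF j y e3; exact: derive_val.
have sum3 (f : 'I_3 -> R) : \sum_(i < 3) f i = f ax0 + f ax1 + f ax2.
  rewrite !big_ord_recr big_ord0 /= add0r; congr (f _ + f _ + f _); exact: val_inj.
have ReImI (a : C) : complex.Re (- ('i%C * a)) = complex.Im a /\ complex.Im (- ('i%C * a)) = - complex.Re a.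
  by case: a => a b; rewrite /= !mul0r !mul1r sub0r opprK add0r.
split; first by rewrite /divergence sum3 !pdre -!Re_addc h0.
split; first by rewrite /divergence sum3 !pdim -!Im_addc h0.
split; apply/rowP => k; rewrite ?dtre ?dtim !mxE.
- by case: (ax_cases k) => -> /=; rewrite !pdim -Im_oppc -Im_addc ?h1 ?h2 ?h3 (ReImI _).2.
- by case: (ax_cases k) => -> /=; rewrite !pdre -Re_oppc -Re_addc ?h1 ?h2 ?h3 (ReImI _).1.
Qed.

Local Notation hf := ((2^-1 : R)%:C%C).

(* F1 + i F2 = g, F1 - i F2 = h + conj q and F3 = f, where q is arbitrary. *)
Definition wave_field (f g h q : C -> R -> C) (j : 'I_3) (x : 'rV[R]_3) : C :=
  let e := wbar x in let u := zc x in let H := h e u + conjc (q e u) in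
  if j == ax0 then (g e u + H) * hf
  else if j == ax1 then (g e u - H) * (- 'i%C * hf) else f e u.

Lemma maxwell_wave_field f g h q : pol f -> pol g -> pol h -> pol q ->
  wave_potentials f g h -> maxwell (re_field (wave_field f g h q)) (im_field (wave_field f g h q)).
Proof.
move=> pf pg ph pq [fe [fu [ge [hu [df dg dh]]]]].
have [_ [_ [_ _ [qe [qu [_ [_ [dq _ _]]]]]]]] := wave_potentials_exist pq.
pose DG x v := ge (wbar x) (zc x) * wbar v + fe (wbar x) (zc x) * (zc v)%:C%C.
pose DH x v := - fu (wbar x) (zc x) * wbar v + hu (wbar x) (zc x) * (zc v)%:C%C
   + conjc (qe (wbar x) (zc x) * wbar v + qu (wbar x) (zc x) * (zc v)%:C%C).
pose DF x v := fe (wbar x) (zc x) * wbar v + fu (wbar x) (zc x) * (zc v)%:C%C.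
pose D (j : 'I_3) x v : C := if j == ax0 then (DG x v + DH x v) * hf
  else if j == ax1 then (DG x v - DH x v) * (- 'i%C * hf) else DF x v.
have cH : csm (fun x => h (wbar x) (zc x) + conjc (q (wbar x) (zc x))).
  by apply: csmD; [exact: csm_pol|apply: csmJ; exact: csm_pol].
have dH x v : cder (fun x => h (wbar x) (zc x) + conjc (q (wbar x) (zc x))) x v (DH x v).
  by apply: cderD; [exact: dh|apply: cderJ; exact: dq].
have eE i j : (evec i : 'rV[R]_3) 0 j = (j == i)%:R by rewrite /evec mxE /=.
have wb0 : wbar (evec ax0 : 'rV[R]_3) = 1.
  by apply: complex_eqP; rewrite /wbar /wc !eE //= oppr0.
have wb1 : wbar (evec ax1 : 'rV[R]_3) = - 'i%C.
  by apply: complex_eqP; rewrite /wbar /wc !eE //= ?oppr0.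
have wb2 : wbar (evec ax2 : 'rV[R]_3) = 0.
  by apply: complex_eqP; rewrite /wbar /wc !eE //= ?oppr0.
have z0 : zc (evec ax0 : 'rV[R]_3) = 0 by rewrite /zc eE.
have z1 : zc (evec ax1 : 'rV[R]_3) = 0 by rewrite /zc eE.
have z2 : zc (evec ax2 : 'rV[R]_3) = 1 by rewrite /zc eE.
apply: (maxwell_wave (D := D)).
- move=> j; case: (ax_cases j) => ->; rewrite /wave_field /=.
  + by apply: csmM; [apply: csmD => //; exact: csm_pol|exact: csm_cst].
  + by apply: csmM; [apply: csmB => //; exact: csm_pol|exact: csm_cst].
  + exact: csm_pol.
- move=> j x v; case: (ax_cases j) => ->; rewrite /wave_field /D /=; last exact: df.
  + have := cderM (cderD (dg x v) (dH x v)) (cder_cst hf x v).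
    by rewrite mulr0 addr0.
  + have := cderM (cderD (dg x v) (cderN (dH x v))) (cder_cst (- 'i%C * hf) x v).
    by rewrite mulr0 addr0.
all: move=> x; rewrite /D /= /DG /DH /DF !(wb0, wb1, wb2, z0, z1, z2).
all: move: (ge _ _) (fe _ _) (fu _ _) (hu _ _) (qe _ _) (qu _ _).
all: move=> [a1 a2] [b1 b2] [c1 c2] [d1 d2] [q1 q2] [r1 r2].
all: by apply: complex_eqP; rewrite /=; field.
Qed.

End MaxwellWaves.

Section Interpolation.
Context {R : realType}.
Local Notation C := R[i].
Variable Lam : set 'rV[R]_3.

Definition ev (P : C -> R -> C) (Y : 'rV[R]_3) : C := P (wbar Y) (zc Y).

(* Near X the set Lam is an arc on which wbar = p(z) + b Q, where Q is real and
   Q^2 = D(z): Q = 0 at a regular point of z, and Q is a square root branching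
   at a fold of z. *)
Definition germ (X : 'rV[R]_3) (rho : R) (p : R -> C) (b : C) (D : R -> C) (Q : C -> R -> C) :=
  [/\ csm p, csm D, pol Q, D (zc X) = 0 & forall Y, Lam Y -> `|Y - X| < rho ->
    [/\ wbar Y = p (zc Y) + b * ev Q Y, ev Q Y ^+ 2 = D (zc Y) & conjc (ev Q Y) = ev Q Y]].

Definition germ_fun (X : 'rV[R]_3) (rho : R) (Q : C -> R -> C) (v : 'rV[R]_3 -> C) :=
  exists r a b, [/\ 0 < r, csm a, csm b & forall Y, Lam Y -> `|Y - X| < rho ->
    `|zc Y - zc X| < r -> v Y = a (zc Y) + b (zc Y) * ev Q Y].

Lemma csm_local_inverse (n : R -> C) (c : R) : csm n -> n c != 0 ->
  exists m r, [/\ csm m, 0 < r & forall u, `|u - c| < r -> m u * n u = 1].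
Proof.
move=> [n1 n2] nc; pose N2 u := complex.Re (n u) ^+ 2 + complex.Im (n u) ^+ 2.
have sN : sm N2 by apply: smD; exact: smX.
have Nc : 0 < N2 c.
  rewrite lt_neqAle addr_ge0 ?sqr_ge0 // andbT eq_sym paddr_eq0 ?sqr_ge0 // !sqrf_eq0.
  by apply: contra nc => /andP[/eqP h1 /eqP h2]; apply/eqP/complex_eqP.
have [r r0 hr] := continuous_near c (sm_continuous sN) Nc.
have r3 : 0 < r / 3 by rewrite divr_gt0.
pose b u := cutoff ((u - c) / (r / 3)).
have sb : sm b := sm_comp sm_cutoff (sm_affine c (r / 3)).
pose m2 u := b u * N2 u + (1 - b u).
have m20 u : 0 < m2 u.
  have /andP[b0 b1] := cutoff_itv ((u - c) / (r / 3)); rewrite -/(b u) in b0 b1.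
  have [h|h] := ltP `|u - c| r.
    have := hr _ h; rewrite ltr_norml => /andP[h1 _].
    have Nu : 0 < N2 u by lra.
    rewrite /m2; have [b2|b2] := leP (b u) 2^-1.
      by have := mulr_ge0 b0 (ltW Nu); lra.
    have : 0 < b u * N2 u by apply: mulr_gt0 => //; lra.
    lra.
  by rewrite /m2 /b cutoff_zoom0 //; lra.
exists (fun u => conjc (n u) * ((m2 u)^-1)%:C%C), (r / 3); split=> //.
  apply: csmM; first exact: csmJ.
  apply: csm_complex; last exact: sm_cst.
  apply: smV => [u|]; first by rewrite gt_eqF.
  by apply: smD; [exact: smM|apply: smB => //; exact: sm_cst].
move=> u hu; have bu : b u = 1 by rewrite /b cutoff_zoom1 // ltW.
change (conjc (n u) * ((m2 u)^-1)%:C%C * n u = 1).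
have : m2 u = N2 u by rewrite /m2 bu mul1r subrr addr0.
have Mn : m2 u != 0 by rewrite gt_eqF.
move: (m2 u) Mn => M Mn E.

move: Mn; rewrite E /N2; case: (n u) => x y /= Mn.
by apply: complex_eqP => /=; field.
Qed.

Section AtGerm.
Variables (X : 'rV[R]_3) (rho : R) (p : R -> C) (b : C) (D : R -> C) (Q : C -> R -> C).
Hypothesis g : germ X rho p b D Q.
Let gf := germ_fun X rho Q.

Lemma germ_fun_z (a : R -> C) : csm a -> gf (fun Y => a (zc Y)).
Proof.
move=> sa; exists 1, a, (fun=> 0); split=> // [|Y _ _ _]; first exact: csm_cst.
by rewrite mul0r addr0.
Qed.

Lemma germ_funD u v : gf u -> gf v -> gf (fun Y => u Y + v Y).
Proof.
move=> [r [a1 [b1 [r0 sa1 sb1 h]]]] [r' [a2 [b2 [r0' sa2 sb2 h']]]].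
exists (Num.min r r'), (fun z => a1 z + a2 z), (fun z => b1 z + b2 z).
split=> [|||Y LY YX]; [by rewrite lt_min r0|exact: csmD|exact: csmD|].
by rewrite lt_min => /andP[z1 z2]; rewrite h // h' //; ring.
Qed.

Lemma germ_funM u v : gf u -> gf v -> gf (fun Y => u Y * v Y).
Proof.
have [_ sD _ _ hQ] := g.
move=> [r [a1 [b1 [r0 sa1 sb1 h]]]] [r' [a2 [b2 [r0' sa2 sb2 h']]]].
exists (Num.min r r'), (fun z => a1 z * a2 z + b1 z * b2 z * D z), (fun z => a1 z * b2 z + b1 z * a2 z).
split=> [|||Y LY YX]; first by rewrite lt_min r0.
- by apply: csmD; [exact: csmM|apply: csmM => //; exact: csmM].
- by apply: csmD; exact: csmM.
rewrite lt_min => /andP[z1 z2]; rewrite h // h' //.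
by have [_ <- _] := hQ Y LY YX; ring.
Qed.

Lemma germ_funJ v : gf v -> gf (fun Y => conjc (v Y)).
Proof.
have [_ _ _ _ hQ] := g.
move=> [r [a1 [b1 [r0 sa1 sb1 h]]]].
exists r, (fun z => conjc (a1 z)), (fun z => conjc (b1 z)).
split=> // [||Y LY YX z1]; [exact: csmJ|exact: csmJ|].
have [_ _ cQ] := hQ Y LY YX.
by rewrite h // rmorphD rmorphM /= cQ.
Qed.

Lemma germ_fun_wbar : gf wbar.
Proof.
have [sp _ _ _ hQ] := g.
exists 1, p, (fun=> b); split=> // [|Y LY YX _]; first exact: csm_cst.
by have [-> _ _] := hQ Y LY YX.
Qed.

Lemma germ_fun_ev P : pol P -> gf (ev P).
Proof.
elim=> [|a q sa pq IH]; first exact: (germ_fun_z (@csm_cst R _ 0)).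
exact: (germ_funD (germ_fun_z sa) (germ_funM germ_fun_wbar IH)).
Qed.

Hypothesis LX : Lam X.
Hypothesis rho0 : 0 < rho.

Lemma germ_Q0 : ev Q X = 0.
Proof.
have [_ _ _ D0 hQ] := g.
have XX : `|X - X| < rho by rewrite subrr normr0.
have [_ h _] := hQ X LX XX.
by apply/eqP; rewrite -sqrf_eq0 h D0.
Qed.

Lemma germ_funV v : gf v -> v X != 0 -> gf (fun Y => (v Y)^-1) /\
  exists2 r : R, 0 < r & forall Y, Lam Y -> `|Y - X| < rho -> `|zc Y - zc X| < r -> v Y != 0.
Proof.
have [_ sD _ D0 hQ] := g.
move=> [r [a1 [b1 [r0 sa1 sb1 h]]]] vX.
have vXE : v X = a1 (zc X).
  by rewrite h ?germ_Q0 ?mulr0 ?addr0 // subrr normr0.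
pose n z := a1 z ^+ 2 - b1 z ^+ 2 * D z.
have sn : csm n by apply: csmB; [exact: csmM|apply: csmM => //; exact: csmM].
have nX : n (zc X) != 0 by rewrite /n D0 mulr0 subr0 expf_neq0 // -vXE.
have [m [r1 [sm1 r10 hm]]] := csm_local_inverse sn nX.
have E Y : Lam Y -> `|Y - X| < rho -> `|zc Y - zc X| < Num.min r r1 ->
    v Y * (a1 (zc Y) * m (zc Y) + - (b1 (zc Y) * m (zc Y)) * ev Q Y) = 1.
  move=> LY YX; rewrite lt_min => /andP[z1 z2]; have [_ EQ _] := hQ Y LY YX.
  by rewrite -(hm _ z2) h // /n -EQ; ring.
have vY Y : Lam Y -> `|Y - X| < rho -> `|zc Y - zc X| < Num.min r r1 -> v Y != 0.
  move=> LY YX zY; apply/eqP => v0; have := E Y LY YX zY.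
  by rewrite v0 mul0r => /eqP; rewrite eq_sym oner_eq0.
have r01 : 0 < Num.min r r1 by rewrite lt_min r0.
split; last by exists (Num.min r r1).
exists (Num.min r r1), (fun z => a1 z * m z), (fun z => - (b1 z * m z)).
split=> [//|||Y LY YX zY]; [exact: csmM|by apply: csmN; exact: csmM|].
by apply: (mulfI (vY Y LY YX zY)); rewrite E // mulfV // vY.
Qed.

End AtGerm.

Lemma germ_funN X rho Q v : germ_fun X rho Q v -> germ_fun X rho Q (fun Y => - v Y).
Proof.
move=> [r [a1 [b1 [r0 sa1 sb1 h]]]].
exists r, (fun z => - a1 z), (fun z => - b1 z); split=> // [||Y LY YX z1]; [exact: csmN|exact: csmN|].
by rewrite h //; ring.
Qed.

Lemma vec3_eq (X Y : 'rV[R]_3) : wbar X = wbar Y -> zc X = zc Y -> X = Y.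
Proof.
move=> [h0 /oppr_inj h1] h2; apply/rowP => j.
by case: (ax_cases j) => ->.
Qed.

Variable v : 'rV[R]_3 -> C.
Hypothesis cLam : compact Lam.
Hypothesis hv : forall X, Lam X -> exists rho p b D Q,
  [/\ 0 < rho, germ X rho p b D Q & germ_fun X rho Q v].

(* Over one height c: the points of Lam at that height are added one at a time,
   P being the product of the equations of the arcs already treated. *)
Lemma interpolation_at_level (c : R) : exists eta f, [/\ 0 < eta, pol f &
  forall Y, Lam Y -> `|zc Y - c| < eta -> ev f Y = v Y].
Proof.
have hv' X : exists rho : R, Lam X -> 0 < rho /\ exists p b D Q,
    germ X rho p b D Q /\ germ_fun X rho Q v.
  have [LX|nLX] := pselect (Lam X); last by exists 0.
  by have [rho [p [b [D [Q [h1 h2 h3]]]]]] := hv LX; exists rho => _; split=> //; exists p, b, D, Q.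
have [rho hrho] := choice hv'.
pose ok eta f P Y := `|zc Y - c| < eta -> ev f Y = v Y /\ ev P Y = 0.
pose Inv A := exists eta f P, [/\ 0 < eta, pol f, pol P, forall Y, Lam Y -> A Y -> ok eta f P Y &
  forall X, Lam X -> zc X = c -> ev P X = 0 -> forall Y, Lam Y -> `|Y - X| < rho X -> ok eta f P Y].
suff [eta [f [P [eta0 pf pP h _]]]] : Inv Lam.
  by exists eta, f; split=> // Y LY Yc; have [] := h Y LY LY Yc.
have okW eta eta' f P Y : eta' <= eta -> ok eta f P Y -> ok eta' f P Y.
  by move=> le h h'; apply: h; exact: lt_le_trans le.
apply: compact_ind => //.
- exists 1, (fun _ _ => 0), (fun _ _ => 1); split=> //; [exact: pol0|exact: (polC (@csm_cst R _ 1))|].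
  by move=> X _ _ /eqP; rewrite /ev oner_eq0.
- move=> A B BA [eta [f [P [h1 h2 h3 h4 h5]]]]; exists eta, f, P; split=> // Y LY BY.
  by apply: h4 => //; exact: BA.
move=> X0 LX0; have zcle (Y Z : 'rV[R]_3) : `|zc Y - zc Z| <= `|Y - Z|.
  by have := rV_norm_coord (Y - Z) ax2; rewrite !mxE.
have [zX0|zX0] := eqVneq (zc X0) c; last first.
  pose r := `|zc X0 - c| / 2.
  have r0 : 0 < r by rewrite divr_gt0 // normr_gt0 subr_eq0.
  exists r => // A [eta [f [P [h1 h2 h3 h4 h5]]]].
  exists (Num.min eta r), f, P; split=> //; first by rewrite lt_min h1.
    move=> Y LY [AY|]; first by apply: okW (h4 Y LY AY); rewrite ge_min lexx.
    rewrite -ball_normE /= => YX; rewrite /ok lt_min => /andP[_ hr]; exfalso.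
    have := zcle X0 Y; have := ler_normD (zc X0 - zc Y) (zc Y - c).
    by rewrite subrKA; move: hr YX; rewrite /r; lra.
  by move=> X LX Xc PX Y LY YX; apply: okW (h5 X LX Xc PX Y LY YX); rewrite ge_min lexx.
have [rho0 [p [b [D [Q [g gv]]]]]] := hrho X0 LX0.
exists (rho X0) => // A [eta [f [P [eta0 pf pP hA hP]]]].
have [PX0|PX0] := eqVneq (ev P X0) 0.
  exists eta, f, P; split=> // Y LY [AY|]; first exact: hA.
  by rewrite -ball_normE /= distrC => YX; exact: (hP X0).
have [r1 [a1 [b1 [r10 sa1 sb1 hg]]]] : germ_fun X0 (rho X0) Q (fun Y => (v Y - ev f Y) * (ev P Y)^-1).
  apply: (germ_funM g); first by apply: germ_funD => //; apply: germ_funN; exact: germ_fun_ev g _ pf.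
  exact: (germ_funV g LX0 rho0 (germ_fun_ev g pP) PX0).1.
have [sp sD pQ D0 hQ] := g.
pose g1 e u := a1 u + b1 u * Q e u.
have pg1 : pol g1 by apply: polD; [exact: polC|apply: polM => //; exact: polC].
pose P0 (e : C) u := (e - p u) ^+ 2 - b ^+ 2 * D u.
have pP0 : pol P0.
  apply: polB; last by apply: polC; apply: csmM => //; exact: csm_cst.
  by apply: polM; (apply: polB; [exact: polX|exact: polC]).
have P0Y Y : Lam Y -> `|Y - X0| < rho X0 -> ev P0 Y = 0.
  move=> LY YX; have [E1 E2 _] := hQ Y LY YX.
  by rewrite /ev /P0 E1 -E2; ring.
have [_ [r2 r20 hPn]] := germ_funV g LX0 rho0 (germ_fun_ev g pP) PX0.
have news Y : Lam Y -> `|Y - X0| < rho X0 -> `|zc Y - c| < Num.min r1 r2 ->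
    ev f Y + ev P Y * ev g1 Y = v Y.
  move=> LY YX; rewrite -zX0 lt_min => /andP[z1 z2].
  rewrite {3}/ev /g1 -/(ev Q Y) -hg // mulrC mulfVK ?hPn //.
  by rewrite addrC subrK.
have olds eta' Y : eta' <= eta -> ok eta f P Y ->
    ok eta' (fun e u => f e u + P e u * g1 e u) (fun e u => P e u * P0 e u) Y.
  move=> le h hY; have [h1 h2] := h (lt_le_trans hY le).
  by rewrite /ev -/(ev P Y) -/(ev f Y) h1 h2 !mul0r addr0.
exists (Num.min eta (Num.min r1 r2)), (fun e u => f e u + P e u * g1 e u), (fun e u => P e u * P0 e u).
have le1 : Num.min eta (Num.min r1 r2) <= eta by rewrite ge_min lexx.
have newok Y : Lam Y -> `|Y - X0| < rho X0 ->
    ok (Num.min eta (Num.min r1 r2)) (fun e u => f e u + P e u * g1 e u) (fun e u => P e u * P0 e u) Y.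
  move=> LY YX; rewrite /ok lt_min => /andP[_ hr].
  by split; [exact: news|rewrite /ev -/(ev P0 Y) P0Y // mulr0].
split.
- by rewrite !lt_min eta0 r10 r20.
- by apply: polD => //; exact: polM.
- exact: polM.
- move=> Y LY [AY|]; first by apply: olds le1 _; exact: hA.
  by rewrite -ball_normE /= distrC => YX; exact: newok.
move=> X LX Xc /eqP; rewrite {1}/ev mulf_eq0 => /orP[/eqP PX|PX] Y LY YX.
  by apply: olds le1 _; exact: (hP X).
suff XX0 : X = X0 by apply: newok => //; rewrite -XX0.
apply: vec3_eq; last by rewrite Xc.
have X00 : `|X0 - X0| < rho X0 by rewrite subrr normr0.
have [E _ _] := hQ X0 LX0 X00.
move: PX; rewrite /P0 Xc -zX0 D0 mulr0 subr0 sqrf_eq0 subr_eq0 => /eqP ->.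
by rewrite E (germ_Q0 g LX0 rho0) mulr0 addr0.
Qed.

Theorem pol_interpolation : exists2 f, pol f & forall Y, Lam Y -> ev f Y = v Y.
Proof.
pose Inv A := exists2 f, pol f & forall Y, Lam Y -> A Y -> ev f Y = v Y.
suff [f pf h] : Inv Lam by exists f => // Y LY; exact: h.
apply: compact_ind => //; first by exists (fun _ _ => 0) => //; exact: pol0.
  by move=> A B BA [f pf h]; exists f => // Y LY BY; apply: h => //; exact: BA.
move=> X LX; have [eta [f1 [eta0 pf1 h1]]] := interpolation_at_level (zc X).
have r0 : 0 < eta / 3 by rewrite divr_gt0.
exists (eta / 3) => // A [f pf h].
pose b (u : R) : C := (cutoff ((u - zc X) / (eta / 3)))%:C%C.
have sb : csm b.
  apply: csm_complex; last exact: sm_cst.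
  exact: (sm_comp sm_cutoff (sm_affine (zc X) (eta / 3))).
exists (fun e u => f e u + b u * (f1 e u - f e u)).
  by apply: polD => //; apply: polZ => //; exact: polB.
move=> Y LY; rewrite /ev -/(ev f Y) -/(ev f1 Y) => -[AY|].
  rewrite h //; have [zl|zl] := ltP `|zc Y - zc X| eta.
    by rewrite h1 // subrr mulr0 addr0.
  by rewrite /b cutoff_zoom0 ?mul0r ?addr0 //; lra.
rewrite -ball_normE /= distrC => YX.
have zY : `|zc Y - zc X| < eta / 3.
  by have := rV_norm_coord (Y - X) ax2; rewrite !mxE => /le_lt_trans; apply.
rewrite /b cutoff_zoom1 ?ltW // mul1r addrC subrK; apply: h1 => //; lra.
Qed.

End Interpolation.

Section FoldedLinks.
Context {R : realType} (n : nat).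
Local Notation C := R[i].
Implicit Types K L : 'I_n -> R -> 'rV[R]_3.

Lemma isotopic_link L K H : link L -> (forall i, sm (K i)) ->
  (forall i s, K i (s + 1) = K i s) -> sm_isotopy H ->
  (forall i s, H 1 (L i s) = K i s) -> link K.
Proof.
move=> lL sK pK [_ _ Hinv] HLK; have [cL dL] := lL.
have [G [sG GK KG]] : exists G, [/\ sm G, cancel (H 1) G & cancel G (H 1)].
  by apply: Hinv; rewrite ler01 lexx.
have GKL i s : G (K i s) = L i s by rewrite -HLK GK.
split=> [i|i j ij].
  have [sL [_ [iL L'0]]] := cL i.
  split; first exact: sm_smooth.
  split=> //; split=> [s u hs hu E|s].
    by apply: iL => //; rewrite -!GKL E.
  apply: contra (L'0 s) => /eqP K'0.
  have EL : L i = G \o K i by apply/funext => u; rewrite /= GKL.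
  have dK := sm_differentiable s (sK i); have dG := sm_differentiable (K i s) sG.
  rewrite EL deriveE; last exact: (differentiable_comp dK dG).
  by rewrite (diff_comp dK dG) /= -(deriveE _ dK) K'0 linear0.
apply/seteqP; split=> // Y [[s _ <-] [u _ E]].
have : L j u = L i s by rewrite -!GKL E.
by move=> /(link_eq lL) [/esym/eqP]; rewrite (negPf ij).
Qed.

Lemma folded_link_exists L : link L -> exists K H, [/\ link K, forall i, sm (K i),
  forall i, folds_quadratically (K i), sm_isotopy H & forall i s, H 1 (L i s) = K i s].
Proof.
move=> lL; have [e e0 he] := link_perturbation lL.
have [cL _] := lL.
have H i := spline_approximation (smooth_sm (cL i).1) (cL i).2.1 e0.
have [K hK] := choice H.
have sK i : sm (K i) by have [] := hK i.
have pK i s : K i (s + 1) = K i s by have [_ ->] := hK i.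
have [i s j|i s j|Phi [iPhi EPhi]] := he K sK pK.
- by have [_ _ h _ _] := hK i.
- by have [_ _ _ h _] := hK i.
exists K, Phi; split=> //; first exact: isotopic_link lL sK pK iPhi EPhi.
by move=> i; have [] := hK i.
Qed.

Variable K : 'I_n -> R -> 'rV[R]_3.
Hypothesis lK : link K.
Hypothesis sK : forall i, sm (K i).
Hypothesis fK : forall i, folds_quadratically (K i).

Lemma curve_periodic i s : K i (s + 1) = K i s.
Proof. by have [cK _] := lK; have [_ []] := cK i. Qed.

Lemma curve_derive_eq i j s u : K i s = K j u -> i = j /\ 'D_1 (K i) s = 'D_1 (K j) u.
Proof.
move=> /(link_eq lK)[<- [m ->]]; split=> //.
apply/rowP => l; rewrite !derive_row //.
have sl : sm (fun s => K i s 0 l) := sm_comp (sm_coord l) (sK i).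
by apply: (periodic_int (f := 'D_1 (fun s => K i s 0 l))); apply: derive_periodic => // t; rewrite curve_periodic.
Qed.

Lemma curve_data (I : {set 'I_n}) : exists T : 'rV[R]_3 -> 'rV[R]_3, exists c : 'rV[R]_3 -> bool,
  forall i s, T (K i s) = 'D_1 (K i) s /\ c (K i s) = (i \in I).
Proof.
have H Y : exists Tc : 'rV[R]_3 * bool, forall i s, K i s = Y ->
    Tc.1 = 'D_1 (K i) s /\ Tc.2 = (i \in I).
  have [[i [s E]]|nY] := pselect (exists i s, K i s = Y).
    exists ('D_1 (K i) s, i \in I) => j u E'.
    have EE : K i s = K j u by rewrite E E'.
    by have [ij ->] := curve_derive_eq EE; rewrite ij.
  by exists (0, false) => i s E; case: nY; exists i, s.
have [Tc hTc] := choice H.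
by exists (fun Y => (Tc Y).1), (fun Y => (Tc Y).2) => i s; exact: hTc.
Qed.

Lemma wc_derive i s : wc ('D_1 (K i) s) =
  Complex ('D_1 (fun s => K i s 0 ax0) s) ('D_1 (fun s => K i s 0 ax1) s).
Proof. by rewrite /wc !derive_row. Qed.

Lemma is_derive_quadratic (a b c s0 s : R) :
  is_derive s 1 (fun s : R => a + b * (s - s0) + c * (s - s0) ^+ 2) (b + 2 * c * (s - s0)).
Proof.
have d1 : is_derive s 1 (fun s : R => s - s0) 1.
  by have := is_deriveB (is_derive_id s 1) (is_derive_cst (s0 : R) s 1); rewrite subr0.
have d2 := is_deriveMf (is_derive_cst (b : R) s 1) d1.
have d3 := is_deriveMf (is_derive_cst (c : R) s 1) (is_deriveXf 2 d1).
apply: (is_derive_eq (is_deriveD (is_deriveD (is_derive_cst (a : R) s 1) d2) d3)).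
by rewrite /cst /=; ring.
Qed.

Lemma derive_locally_quadratic (f : R -> R) (a b c s0 r s : R) :
  (forall s, `|s - s0| < r -> f s = a + b * (s - s0) + c * (s - s0) ^+ 2) ->
  `|s - s0| < r -> 'D_1 f s = b + 2 * c * (s - s0).
Proof.
move=> hf sr; have d := is_derive_quadratic a b c s0 s.
rewrite -(derive_val (is_derive := d)); apply: near_eq_derive.
have r1 : 0 < r - `|s - s0| by rewrite subr_gt0.
apply/nbhs_normP; exists (r - `|s - s0|) => //= u hu; apply: hf.
have {hu} hu : `|u - s| < r - `|s - s0| by rewrite distrC.
have := ler_normD (u - s) (s - s0); rewrite subrKA; lra.
Qed.

Variables (I : {set 'I_n}) (T : 'rV[R]_3 -> 'rV[R]_3) (sel : 'rV[R]_3 -> bool).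
Hypothesis hT : forall i s, T (K i s) = 'D_1 (K i) s /\ sel (K i s) = (i \in I).

Lemma curve_germs X : lset K X -> exists rho p b D Q,
  [/\ 0 < rho, germ (lset K) X rho p b D Q &
  [/\ germ_fun (lset K) X rho Q (fun Y => wc (T Y)),
     germ_fun (lset K) X rho Q (fun Y => (zc (T Y))%:C%C) &
     germ_fun (lset K) X rho Q (fun Y => (sel Y)%:R)]].
Proof.
move=> [i _ [s0 _ <-]].
have szi j : sm (fun s => K i s 0 j) := sm_comp (sm_coord j) (sK i).
have arc r : 0 < r -> exists2 rho, 0 < rho & forall Y, lset K Y -> `|Y - K i s0| < rho ->
    exists2 s, `|s - s0| < r & Y = K i s by exact: arc_nbhs.
have sel_germ rho r Q : (forall Y, lset K Y -> `|Y - K i s0| < rho ->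
    exists2 s, `|s - s0| < r & Y = K i s) -> germ_fun (lset K) (K i s0) rho Q (fun Y => (sel Y)%:R).
  move=> h; exists 1, (fun=> (i \in I)%:R), (fun=> 0); split=> //; try exact: csm_cst.
  move=> Y LY YX _; have [s _ ->] := h Y LY YX.
  by rewrite (hT i s).2 mul0r addr0.
have [z'0|z'0] := eqVneq ('D_1 (fun s => K i s 0 ax2) s0) 0; last first.
  have [sg [r [_ [ssg r0 _ _ hsg]]]] := local_inverse (szi ax2) z'0.
  have [rho rho0 hrho] := arc r r0.
  have cw : csm (fun s => wbar (K i s)) by apply: csmJ; apply: csm_complex; exact: szi.
  exists rho, (fun u => wbar (K i (sg u))), 0, (fun=> 0), (fun _ _ => 0); split=> //.
    split=> //; [exact: csm_comp cw ssg|exact: csm_cst|exact: pol0|].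
    move=> Y LY YX; have [s sr ->] := hrho Y LY YX.
    by rewrite /ev /zc hsg //; split; rewrite ?mulr0 ?addr0 ?expr0n ?conjc0.
  split; last exact: sel_germ hrho.
    exists 1, (fun u => wc ('D_1 (K i) (sg u))), (fun=> 0); split=> //; try exact: csm_cst.
      under eq_fun do rewrite wc_derive.
      apply: (csm_comp (f := fun s => Complex ('D_1 (fun s => K i s 0 ax0) s) ('D_1 (fun s => K i s 0 ax1) s)) _ ssg).
      by apply: csm_complex; exact: sm_derive.
    move=> Y LY YX _; have [s sr ->] := hrho Y LY YX.
    by rewrite (hT i s).1 /zc hsg // mul0r addr0.
  exists 1, (fun u => (zc ('D_1 (K i) (sg u)))%:C%C), (fun=> 0); split=> //; try exact: csm_cst.
    under eq_fun do rewrite /zc derive_row //.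
    by apply: csm_complex; [exact: (sm_comp (sm_derive (1 : R) (szi ax2)) ssg)|exact: sm_cst].
  move=> Y LY YX _; have [s sr ->] := hrho Y LY YX.
  by rewrite (hT i s).1 {3}/zc hsg // mul0r addr0.
have [r [kap [b0 [c0 [b1 [c1 [r0 kap0 hq]]]]]]] := fK z'0.
have [rho rho0 hrho] := arc r r0.
pose be : C := Complex b0 b1; pose ga : C := Complex c0 c1.
set z0 := K i s0 0 ax2 in hq.
have q2 s : `|s - s0| < r -> K i s 0 ax2 = z0 + 0 * (s - s0) + kap * (s - s0) ^+ 2.
  by move=> /hq[-> _ _]; rewrite mul0r addr0.
have q0 s : `|s - s0| < r -> K i s 0 ax0 = K i s0 0 ax0 + b0 * (s - s0) + c0 * (s - s0) ^+ 2.
  by move=> /hq[_ -> _].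
have q1 s : `|s - s0| < r -> K i s 0 ax1 = K i s0 0 ax1 + b1 * (s - s0) + c1 * (s - s0) ^+ 2.
  by move=> /hq[_ _ ->].
have be0 : be != 0.
  apply/eqP => -[b00 b10].
  have /negP := (lK.1 i).2.2.2 s0; apply; apply/eqP/rowP => j.
  have s00 : `|s0 - s0| < r by rewrite subrr normr0.
  rewrite derive_row // mxE; case: (ax_cases j) => -> //.
    by rewrite (derive_locally_quadratic q0) // b00 subrr mulr0 addr0.
  by rewrite (derive_locally_quadratic q1) // b10 subrr mulr0 addr0.
have cbe0 : conjc be != 0 by rewrite conjc_eq0.
pose h u : R := (u - z0) / kap.
have sh : csm (fun u => (h u)%:C%C) by apply: csm_complex; [exact: sm_affine|exact: sm_cst].
pose p u : C := wbar (K i s0) + conjc ga * (h u)%:C%C.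
have sp : csm p by apply: csmD; [exact: csm_cst|apply: csmM => //; exact: csm_cst].
pose Q (e : C) u := (e - p u) * (conjc be)^-1.
have hE s : `|s - s0| < r -> h (zc (K i s)) = (s - s0) ^+ 2.
  by move=> /hq[zE _ _]; rewrite /h /zc zE; field.
have wE s : `|s - s0| < r -> wbar (K i s) = p (zc (K i s)) + conjc be * (s - s0)%:C%C.
  move=> sr; rewrite /p hE //; apply: complex_eqP; rewrite /wbar /wc q0 // q1 //=; ring.
have QE s : `|s - s0| < r -> ev Q (K i s) = (s - s0)%:C%C.
  by move=> sr; rewrite /ev /Q wE // addrAC subrr add0r mulrC mulKf.
exists rho, p, (conjc be), (fun u => (h u)%:C%C), Q; split=> //.
  split=> //.
  - by apply: polM; [apply: polB; [exact: polX|exact: polC]|apply: polC; exact: csm_cst].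
  - by rewrite /h /zc subrr mul0r.
  move=> Y LY YX; have [s sr ->] := hrho Y LY YX.
  rewrite QE // hE //; split; [exact: wE|by rewrite rmorphXn|exact: conjc_real].
split; last exact: sel_germ hrho.
  exists 1, (fun=> be), (fun=> 2 * ga); split=> //; try exact: csm_cst.
  move=> Y LY YX _; have [s sr ->] := hrho Y LY YX.
  rewrite (hT i s).1 QE // wc_derive (derive_locally_quadratic q0) // (derive_locally_quadratic q1) //.
  by apply: complex_eqP => /=; ring.
exists 1, (fun=> 0), (fun=> (2 * kap)%:C%C); split=> //; try exact: csm_cst.
move=> Y LY YX _; have [s sr ->] := hrho Y LY YX.
rewrite (hT i s).1 QE // /zc derive_row // (derive_locally_quadratic q2) //.
by rewrite !add0r rmorphM.
Qed.

End FoldedLinks.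

Lemma wave_field_components {R : realType} (f g h q : R[i] -> R -> R[i]) (Y : 'rV[R]_3) :
  let F j := wave_field f g h q j Y in let H := ev h Y + conjc (ev q Y) in
  Complex (complex.Re (F ax0)) (complex.Re (F ax1)) = (ev g Y + conjc H) * (2^-1 : R)%:C%C /\
  Complex (complex.Im (F ax0)) (complex.Im (F ax1)) = (ev g Y - conjc H) * (- 'i%C * (2^-1 : R)%:C%C).
Proof.
rewrite /wave_field /ev /=; move: (g _ _) (h _ _) (q _ _) => [a1 a2] [b1 b2] [c1 c2] /=.
by split; apply: complex_eqP => /=; field.
Qed.

Lemma vec3_of_components {R : realType} (u v : 'rV[R]_3) :
  wc u = wc v -> zc u = zc v -> u = v.
Proof. by move=> h; apply: vec3_eq; rewrite /wbar h. Qed.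

Lemma germ_combination {R : realType} (Lam : set 'rV[R]_3) X rho p b D Q
    (W S : 'rV[R]_3 -> R[i]) (g h : R[i] -> R -> R[i]) :
  germ Lam X rho p b D Q -> pol g -> pol h ->
  germ_fun Lam X rho Q W -> germ_fun Lam X rho Q S ->
  germ_fun Lam X rho Q (fun Y => S Y * (2 * W Y - ev g Y) + (1 - S Y) * (ev g Y - 2 * 'i%C * W Y) - conjc (ev h Y)).
Proof.
move=> G pg ph gW gS.
have gc (c : R[i]) : germ_fun Lam X rho Q (fun=> c) := germ_fun_z Lam X rho Q (@csm_cst R _ c).
have gg := germ_fun_ev G pg; have gh := germ_funJ G (germ_fun_ev G ph).
have gB u v : germ_fun Lam X rho Q u -> germ_fun Lam X rho Q v -> germ_fun Lam X rho Q (fun Y => u Y - v Y).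
  by move=> gu gv; apply: germ_funD => //; exact: germ_funN.
have g2 c : germ_fun Lam X rho Q (fun Y => c * W Y) by exact: (germ_funM G (gc c) gW).
apply: (gB _ _ _ gh); apply: germ_funD.
  by apply: (germ_funM G) => //; exact: gB.
by apply: (germ_funM G); exact: gB.
Qed.

Theorem theorem1 (R : realType) (n : nat) (L : 'I_n -> R -> 'rV[R]_3)
  (I : {set 'I_n}) :
  link L ->
  exists E B : R -> 'rV[R]_3 -> 'rV[R]_3,
    maxwell E B /\
    forall t : R,
      exists (C : 'I_n -> R -> 'rV[R]_3) (H : R -> 'rV[R]_3 -> 'rV[R]_3),
        (forall i, i \in I -> closed_field_line (E t) (C i)) /\
        (forall i, i \notin I -> closed_field_line (B t) (C i)) /\
        ambient_isotopy H /\
        (forall i, H 1 @` range (L i) = range (C i)).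
Proof.
move=> lL.
have [K [H [lK sK fK iH HLK]]] := folded_link_exists lL.
have [T [sel hT]] := curve_data lK sK I.
have germs := curve_germs lK sK fK hT.
have cK := lset_compact lK.
pose W Y := wc (T Y); pose Z Y : R[i] := (zc (T Y))%:C%C; pose S Y : R[i] := (sel Y)%:R.
have [X LX|f pf hf] := pol_interpolation (v := fun Y => (1 + 'i%C) * Z Y) cK.
  have [rho [p [b [D [Q [r0 G [_ gZ _]]]]]]] := germs X LX.
  exists rho, p, b, D, Q; split=> //; apply: (germ_funM G) => //.
  exact: (germ_fun_z _ _ _ _ (@csm_cst R _ (1 + 'i%C))).
have [g [h [pg ph wp]]] := wave_potentials_exist pf.
have [X LX|q pq hq] := pol_interpolation
    (v := fun Y => S Y * (2 * W Y - ev g Y) + (1 - S Y) * (ev g Y - 2 * 'i%C * W Y) - conjc (ev h Y)) cK.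
  have [rho [p [b [D [Q [r0 G [gW _ gS]]]]]]] := germs X LX.
  by exists rho, p, b, D, Q; split=> //; apply: germ_combination G _ _ _ _.
pose F := wave_field f g h q.
exists (re_field F), (im_field F); split; first exact: maxwell_wave_field.
move=> t; pose e3 : 'rV[R]_3 := t *: evec ax2.
have K' i s : T (K i s) = 'D_1 (K i) s by have [] := hT i s.
have LKs i s : lset K (K i s) by exists i => //; exists s.
have Z' i s : zc ('D_1 (K i) s) = complex.Re (F ax2 (K i s)) /\ zc ('D_1 (K i) s) = complex.Im (F ax2 (K i s)).
  have -> : F ax2 (K i s) = (1 + 'i%C) * Z (K i s) by rewrite -hf.
  by rewrite /Z K' Re_mulc Im_mulc /= !(mulr0, mul0r, addr0, add0r, subr0, mul1r).
have EI i s : i \in I -> re_field F t (K i s + e3) = 'D_1 (K i) s.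
  move=> iI; apply: vec3_of_components; last by rewrite (Z' i s).1 /re_field {1}/zc mxE addrK.
  have := (wave_field_components f g h q (K i s)).1.
  rewrite /re_field {1}/wc !mxE addrK -/F => ->.
  rewrite hq // /S (hT i s).2 iI /W K' rmorphD /= conjcK.
  move: (ev g _) (ev h _) (wc _) => [a1 a2] [b1 b2] [c1 c2].
  by apply: complex_eqP => /=; field.
have BI i s : i \notin I -> im_field F t (K i s + e3) = 'D_1 (K i) s.
  move=> iI; apply: vec3_of_components; last by rewrite (Z' i s).2 /im_field {1}/zc mxE addrK.
  have := (wave_field_components f g h q (K i s)).2.
  rewrite /im_field {1}/wc !mxE addrK -/F => ->.
  rewrite hq // /S (hT i s).2 (negPf iI) /W K' rmorphD /= conjcK.
  move: (ev g _) (ev h _) (wc _) => [a1 a2] [b1 b2] [c1 c2].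
  by apply: complex_eqP => /=; field.
have D' i s : 'D_1 (fun s => K i s + e3) s = 'D_1 (K i) s.
  have := is_deriveD (sm_is_derive s 1 (sK i)) (is_derive_cst e3 s 1).
  by rewrite addr0 => -[_ <-].
have [cK' _] := lK.
have cC i : closed_curve (fun s => K i s + e3).
  have [_ [pK [iK K'0]]] := cK' i.
  split; first by apply: sm_smooth; apply: smD => //; exact: sm_cst.
  split=> [s|]; first by rewrite pK.
  split=> [s u hs hu /addIr|s]; first exact: iK.
  by rewrite D'.
have K'0 i s : 'D_1 (K i) s != 0 by have [_ [_ [_ ->]]] := cK' i.
exists (fun i s => K i s + e3), (fun tau x => H tau x + tau *: e3); split; last split; last split.
- move=> i iI; split=> // s; rewrite EI // D'; split=> //.
  by exists 1; rewrite scale1r.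
- move=> i iI; split=> // s; rewrite BI // D'; split=> //.
  by exists 1; rewrite scale1r.
- exact: sm_isotopy_translate.
move=> i; apply/seteqP; split=> [_ [_ [s _ <-] <-]|_ [s _ <-]].
  by exists s => //; rewrite HLK scale1r.
by exists (L i s); [exists s|rewrite HLK scale1r].
Qed.
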